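(* Let $M\ge2$ be an integer, $a\in(0,\tfrac1M)$ and $b\in\big(0,M^{1-\frac1{Ma}}\big)$, and let $T_{a,b}:[0,1]^2\to[0,1]^2$ be the two-dimensional heterochaos baker map defined in the context. Then: 1. $T_{a,b}$ has a unique physical measure $\mu_{a,b}$, and its basin covers Lebesgue almost all of $[0,1]^2$; 2. there exist $C>0$ and $s\in(0,1)$ such that for all Lipschitz $\Phi,\Psi:[0,1]^2\to\mathbb R$ and all $n\ge1$, $$\left|\int\Phi\cdot\Psi\circ T_{a,b}^n\,d\mu_{a,b}-\int\Phi\,d\mu_{a,b}\int\Psi\,d\mu_{a,b}\right|\le C\,\bigl(\|\Phi\|_{\mathrm{Lip}}+\|\Psi\|_{\mathrm{Lip}}\bigr)\,s^n.$$
   Context: Define $f_a:[0,1]\to[0,1]$ by $f_a(\omega)=\frac{\omega-(i-1)a}{a}$ for $\omega\in[(i-1)a,ia)$, $i=1,\dots,M$, and $f_a(\omega)=\frac{\omega-Ma}{1-Ma}$ for $\omega\in[Ma,1]$. Define $g_{a,b}:[0,1]^2\to[0,1]$ by $g_{a,b}(\omega,x)=bx+\frac{(i-1)(1-b)}{M}$ for $(\omega,x)\in[(i-1)a,ia)\times[0,1]$, $i=1,\dots,M$, and $g_{a,b}(\omega,x)=2\min_{n\in\mathbb Z}\left|\frac{Mx}{2}-n\right|$ for $(\omega,x)\in[Ma,1]\times[0,1]$. The two-dimensional heterochaos baker map is $T_{a,b}(\omega,x)=(f_a(\omega),g_{a,b}(\omega,x))$. For a map $S:Y\to Y$ and an $S$-invariant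 probability measure $\zeta$, the basin $B(\zeta)$ is the set of $y\in Y$ with $\frac1n\sum_{j=0}^{n-1}\delta_{S^j(y)}\to\zeta$ in the weak-$*$ topology; $\zeta$ is a physical measure if $B(\zeta)$ has positive Lebesgue measure. For Lipschitz $\varphi$, $\|\varphi\|_{\mathrm{Lip}}=\|\varphi\|_\infty+\mathrm{Lip}(\varphi)$, where $\mathrm{Lip}(\varphi)=\sup_{x\ne y}|\varphi(x)-\varphi(y)|/d(x,y)$ with $d$ the Euclidean distance.
   Formalization: In part 2 the bound is proved with the product ‖Φ‖_Lip·‖Ψ‖_Lip in place of the sum ‖Φ‖_Lip+‖Ψ‖_Lip, since the sum bound fails under scaling (tΦ,tΨ), e.g. for Φ=Ψ=ω and n=1. *)

(* Defs.v *)
From HB Require Import structures.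
From mathcomp Require Import all_boot all_order all_algebra.
From mathcomp Require Import all_classical all_reals all_analysis.

Set Implicit Arguments.
Unset Strict Implicit.
Unset Printing Implicit Defensive.

Import Order.TTheory GRing.Theory Num.Def Num.Theory.
Import numFieldNormedType.Exports.

Local Open Scope classical_set_scope.
Local Open Scope ring_scope.

(* MathComp-Analysis world.
   The phase space [0,1]^2 is the subset [sq] of the plane R * R.  Maps and
   observables are total functions on the plane of which only the values on
   [sq] matter, and a probability measure on [0,1]^2 is a Borel probability
   measure [z] on the plane with [z sq = 1]. *)

Notation plane R := (measurableTypeR R * measurableTypeR R)%type.

Section Baker.
Context {R : realType}.
Variables (M : nat) (a b : R).

(* For w in [0, M a), [branch w] is the unique k with k a <= w < (k + 1) a,
   so that k = i - 1 for the branches [(i-1) a, i a), i = 1, ..., M. *)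
Definition branch (w : R) : nat := truncn (w / a).

Definition fa (w : R) : R :=
  if w < M%:R * a then (w - (branch w)%:R * a) / a
  else (w - M%:R * a) / (1 - M%:R * a).

Definition gab (w x : R) : R :=
  if w < M%:R * a then b * x + (branch w)%:R * (1 - b) / M%:R
  else 2 * inf (range (fun n : int => `|M%:R * x / 2 - n%:~R|)).

Definition baker (p : plane R) : plane R := (fa p.1, gab p.1 p.2).

End Baker.

Section Dynamics.
Context {R : realType}.
Implicit Types (S : plane R -> plane R) (z : probability (plane R) R)
  (phi : plane R -> R).

Definition sq : set (plane R) := `[0%R, 1%R] `*` `[0%R, 1%R].

Definition leb2 : set (plane R) -> \bar R :=
  (@lebesgue_measure R \x @lebesgue_measure R)%E.

Definition invariant_prob S z : Prop :=
  z sq = 1%E /\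
  forall A : set (plane R), measurable A -> z (sq `&` S @^-1` A) = z A.

Definition birkhoff_avg S phi (y : plane R) (n : nat) : R :=
  n%:R^-1 * \sum_(j < n) phi (iter j S y).

(* Weak-* convergence of the empirical measures, tested against the
   continuous functions on the compact space [sq]. *)
Definition basin S z : set (plane R) :=
  [set y | sq y /\
    forall phi : R * R -> R, {within sq, continuous phi} ->
      birkhoff_avg S phi y @ \oo --> \int[z]_(p in sq) phi p].

Definition physical S z : Prop :=
  invariant_prob S z /\ (0 < leb2 (basin S z))%E.

(* The norm of the product R * R in the library is the max norm. *)
Definition edist (p q : plane R) : R :=
  Num.sqrt ((p.1 - q.1) ^+ 2 + (p.2 - q.2) ^+ 2).

Definition lipschitz_sq phi : Prop :=
  exists K : R, forall p q, sq p -> sq q -> `|phi p - phi q| <= K * edist p q.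

Definition sup_norm phi : R := sup [set `|phi p| | p in sq].

Definition lip_const phi : R :=
  sup [set r | exists p q,
    [/\ sq p, sq q, p <> q & r = `|phi p - phi q| / edist p q]].

Definition lip_norm phi : R := sup_norm phi + lip_const phi.

End Dynamics.

(* Main.v *)
Require Import Defs.
From HB Require Import structures.
From mathcomp Require Import all_boot all_order all_algebra.
From mathcomp Require Import all_classical all_reals all_analysis.
From mathcomp Require Import measurable_realfun.
From mathcomp Require Import ring lra zify.
Import Order.TTheory GRing.Theory Num.Def Num.Theory.
Import numFieldNormedType.Exports.
Set Implicit Arguments.
Unset Strict Implicit.
Unset Printing Implicit Defensive.
Local Open Scope classical_set_scope.
Local Open Scope ring_scope.

(** The map is a skew product.  Its base map f sends each of the M + 1 base
    intervals affinely onto [0, 1), so it preserves Lebesgue measure, and the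
    intervals visited at successive times are independent, each visited with
    probability equal to its length.  The second coordinate is moved by the map
    attached to the visited interval.  Such a step contracts by b with
    probability M a and expands by at most M with probability 1 - M a, and the
    bound on b says that the logarithm of the Lipschitz constant of a step has
    negative mean.  Hence there is an exponent th in (0, 1] for which the
    th-power of that constant has mean r < 1 ([contracting_on_average]).  The
    fibre has diameter 1, so the product of these th-powers along an orbit
    ([lip_cocycle]) bounds the distance after n steps between any two points of
    one fibre ([synchronization1]), and its mean is r^n ([E_lip_cocycle]).
    The rest is drawn from this estimate.

    Invariant measure.  Composing the fibre maps in the reverse order gives, at
    almost every base point w, a convergent sequence with a limit h(w) that
    satisfies h(w) = g(w, h(f w)) ([backward_limit_equivariant]).  The product
    of Lebesgue measure with the law of h is therefore invariant
    ([phys_measure_invariant]).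

    Decay of correlations.  Fix the initial fibre coordinate and cut n = m + k.
    Replacing the fibre coordinate at time k by 0 costs K r^m.  What remains is
    a correlation of f alone between a Lipschitz function and a bounded one;
    the transfer operator of f multiplies Lipschitz constants by the sum of the
    squares of the lengths, which gives an exponential bound ([exact_mixing]).
    This yields the decay at a fixed fibre coordinate ([decay_fixed]); averaging
    over the law of h yields the decay for the invariant measure.

    Physicality.  Decay at a fixed fibre coordinate makes the second moments of
    centred Birkhoff sums grow linearly ([variance_growth]).  They are then
    summable along the squares after normalization, and Birkhoff averages of a
    Lipschitz observable converge at (w, 0) for almost every w ([ae_birkhoff]).
    Synchronization transports this to every point of the fibre over w.  A
    countable family of products of piecewise affine bumps spans uniform
    approximations of every continuous function, so one null set of base points
    serves all of them ([generic_basin]).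

    Uniqueness.  The basin of another physical measure cannot lie in a null
    set, so it meets the basin above; the two measures then integrate every
    continuous function alike and coincide ([determined_by_continuous]). *)

(** * The baker map and its inverse branches *)

Section BakerMap.
Context {R : realType}.
Variables (M : nat) (a b : R).

Definition tent (x : R) : R := 2 * inf (range (fun n : int => `|M%:R * x / 2 - n%:~R|)).
Definition branch_len (i : nat) : R := if (i < M)%N then a else 1 - M%:R * a.

(** The inverse of f on its i-th interval.  The index M stands for the last
    interval, of length 1 - M a, whose left end M a fits the same formula. *)
Definition inv_branch (i : nat) (t : R) : R := i%:R * a + branch_len i * t.

(** The fibre map over the i-th interval, as a function of the index: the
    law of the second coordinate depends on the base point through it only. *)
Definition fibre_map (i : nat) (x : R) : R :=
  if (i < M)%N then b * x + i%:R * (1 - b) / M%:R else tent x.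

Hypotheses (hM : (2 <= M)%N) (ha0 : 0 < a) (haM : a < 1 / M%:R).
Hypotheses (hb0 : 0 < b) (hb1 : b < 1).

Let M0 : 0 < M%:R :> R.
Proof. by rewrite ltr0n (leq_trans _ hM). Qed.

Lemma Ma_lt1 : M%:R * a < 1.
Proof. by rewrite mulrC -ltr_pdivlMr. Qed.

Lemma branch_len_gt0 i : 0 < branch_len i.
Proof. by rewrite /branch_len; case: ifP => // _; rewrite subr_gt0 Ma_lt1. Qed.

Lemma branch_len_lt1 i : branch_len i < 1.
Proof.
rewrite /branch_len; case: ifP => // _.
  by rewrite (lt_trans haM)// ltr_pdivrMr// mul1r ltr1n.
by rewrite gtrBl mulr_gt0.
Qed.

Lemma sum_branch_len (F : nat -> R) :
  \sum_(i < M.+1) branch_len i * F i = a * \sum_(i < M) F i + (1 - M%:R * a) * F M.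
Proof.
rewrite big_ord_recr/= /branch_len ltnn; congr (_ + _).
by rewrite mulr_sumr; apply: eq_bigr => i _; rewrite ltn_ord.
Qed.

Lemma branch_len_sum1 : \sum_(i < M.+1) branch_len i = 1.
Proof.
have := sum_branch_len (fun=> 1); rewrite sumr_const card_ord mulr1 -mulr_natr mul1r.
by under eq_bigr do rewrite mulr1; move=> ->; rewrite mulrC subrKC.
Qed.

Lemma inv_branch_bounds i t : (i < M)%N -> 0 <= t < 1 ->
  i%:R * a <= inv_branch i t < i.+1%:R * a.
Proof.
move=> iM /andP[t0 t1]; rewrite /inv_branch /branch_len iM lerDl mulr_ge0 ?(ltW ha0)//=.
by rewrite -natr1 mulrDl mul1r ltrD2l gtr_pMr.
Qed.

Lemma inv_branch_symbol i t : (i < M)%N -> 0 <= t < 1 ->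
  (inv_branch i t < M%:R * a) /\ branch a (inv_branch i t) = i.
Proof.
move=> iM t01; have /andP[l u] := inv_branch_bounds iM t01; split.
  by rewrite (lt_le_trans u)// ler_pM2r// ler_nat.
by apply: truncn_def; rewrite ler_pdivlMr// ltr_pdivrMr// l.
Qed.

Lemma inv_branch_top t : 0 <= t -> (inv_branch M t < M%:R * a) = false.
Proof.
move=> t0; apply/negbTE; rewrite -leNgt /inv_branch lerDl mulr_ge0//.
by rewrite ltW// branch_len_gt0.
Qed.

Lemma inv_branch_itv i t : (i <= M)%N -> 0 <= t < 1 -> 0 <= inv_branch i t < 1.
Proof.
move=> iM /andP[t0 t1]; apply/andP; split.
  by rewrite addr_ge0// mulr_ge0// ltW// branch_len_gt0.
move: iM; rewrite leq_eqVlt => /predU1P[->|iM].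
  rewrite /inv_branch /branch_len ltnn; rewrite -subr_gt0.
  rewrite (_ : 1 - _ = (1 - M%:R * a) * (1 - t)); last by ring.
  by rewrite mulr_gt0// subr_gt0 // Ma_lt1.
have [+ _] := inv_branch_symbol iM (introT andP (conj t0 t1)).
by move/lt_trans; apply; exact: Ma_lt1.
Qed.

Lemma fa_inv_branch i t : (i <= M)%N -> 0 <= t < 1 -> fa M a (inv_branch i t) = t.
Proof.
rewrite leq_eqVlt => /predU1P[->|iM] t01; rewrite /fa.
  have /andP[t0 _] := t01; rewrite inv_branch_top// /inv_branch /branch_len ltnn.
  have /lt0r_neq0 h : 0 < 1 - M%:R * a by rewrite subr_gt0 Ma_lt1.
  by field.
have [-> ->] := inv_branch_symbol iM t01.
by rewrite /inv_branch /branch_len iM; have := lt0r_neq0 ha0 => h; field.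
Qed.

Lemma gab_inv_branch i t x : (i <= M)%N -> 0 <= t < 1 ->
  gab M a b (inv_branch i t) x = fibre_map i x.
Proof.
rewrite leq_eqVlt => /predU1P[->|iM] t01; rewrite /gab /fibre_map.
  by have /andP[t0 _] := t01; rewrite inv_branch_top// ltnn.
by have [-> ->] := inv_branch_symbol iM t01; rewrite iM.
Qed.

Lemma branch_lt w : 0 <= w -> w < M%:R * a -> (branch a w < M)%N.
Proof. by move=> w0 wM; rewrite truncn_lt_nat ?divr_ge0 ?ltr_pdivrMr// ltW. Qed.

Lemma branch_itv w : 0 <= w -> (branch a w)%:R * a <= w < (branch a w).+1%:R * a.
Proof.
move=> w0; have := @truncn_itv R (w / a); rewrite divr_ge0 ?(ltW ha0)// => /(_ isT).
by rewrite ler_pdivlMr// ltr_pdivrMr.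
Qed.

Lemma fa_itv w : 0 <= w < 1 -> 0 <= fa M a w < 1.
Proof.
move=> /andP[w0 w1]; rewrite /fa; case: ltP => wM.
  have /andP[l u] := branch_itv w0.
  rewrite divr_ge0 ?subr_ge0 ?(ltW ha0)//= ltr_pdivrMr// mul1r ltrBlDr.
  by rewrite (lt_le_trans u)// -natr1 mulrDl mul1r addrC.
have h : 0 < 1 - M%:R * a by rewrite subr_gt0 Ma_lt1.
apply/andP; split; first by apply: divr_ge0; [rewrite subr_ge0|exact: ltW].
by rewrite ltr_pdivrMr// mul1r ltrD2r.
Qed.

Lemma fa_itvc w : 0 <= w <= 1 -> 0 <= fa M a w <= 1.
Proof.
move=> /andP[w0]; rewrite le_eqVlt => /predU1P[->|w1].
  rewrite /fa ltNge (ltW Ma_lt1)/= divff ?lexx ?ler01//.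
  by rewrite gt_eqF// subr_gt0 Ma_lt1.
by have := @fa_itv w; rewrite w0 w1 => /(_ isT)/andP[-> /ltW ->].
Qed.

Let distZ_lb (y : R) : lbound (range (fun n : int => `|y - n%:~R|)) 0.
Proof. by move=> _ [n _ <-]. Qed.

Let distZ_le (y : R) (n : int) :
  inf (range (fun n : int => `|y - n%:~R|)) <= `|y - n%:~R|.
Proof. by apply: ge_inf; [exists 0; exact: distZ_lb|exists n]. Qed.

Let distZ_lip (y z : R) :
  inf (range (fun n : int => `|y - n%:~R|)) - inf (range (fun n : int => `|z - n%:~R|))
  <= `|y - z|.
Proof.
rewrite lerBlDr -lerBlDl; apply: lb_le_inf; first by exists `|z - 0%:~R|; exists 0.
move=> _ [n _ <-]; rewrite lerBlDl (le_trans (distZ_le y n))//.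
rewrite (le_trans _ (ler_normD _ _))//.
by rewrite le_eqVlt (_ : _ - _ = y - z + (z - n%:~R)) ?eqxx//; ring.
Qed.

Lemma tent_lip x y : `|tent x - tent y| <= M%:R * `|x - y|.
Proof.
suff h u v : tent u - tent v <= M%:R * `|u - v|.
  by rewrite ler_norml h andbT lerNl opprB distrC h.
rewrite /tent -mulrBr -ler_pdivlMl// (le_trans (distZ_lip _ _))//.
rewrite (_ : _ - _ = (M%:R / 2) * (u - v)); last by field.
by rewrite normrM ger0_norm ?divr_ge0// mulrA [2^-1 * _]mulrC.
Qed.

(** One of the two integers around M x / 2 is at distance at most 1/2. *)
Lemma tent_itv x : 0 <= tent x <= 1.
Proof.
rewrite /tent mulr_ge0//=; last first.
  by apply: lb_le_inf; [exists `|M%:R * x / 2 - 0%:~R|; exists 0|exact: distZ_lb].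
set y := M%:R * x / 2; have /andP[l u] := floor_itv y.
rewrite -ler_pdivlMl// mulr1.
have := distZ_le y (Num.floor y); have := distZ_le y (Num.floor y + 1).
have -> : `|y - (Num.floor y)%:~R| = y - (Num.floor y)%:~R.
  by rewrite ger0_norm// subr_ge0.
have -> : `|y - (Num.floor y + 1)%:~R| = (Num.floor y + 1)%:~R - y.
  by rewrite ltr0_norm ?subr_lt0// opprB.
by rewrite intrD => h1 h2; rewrite /y in h1 h2 *; lra.
Qed.

Lemma gab_itv w x : 0 <= w -> 0 <= x <= 1 -> 0 <= gab M a b w x <= 1.
Proof.
move=> w0 /andP[x0 x1]; rewrite /gab; case: ltP => wM; last exact: tent_itv.
have iM := branch_lt w0 wM.
have h : (branch a w)%:R / M%:R <= 1 :> R.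
  by rewrite ler_pdivrMr// mul1r ler_nat ltnW.
rewrite mulrAC; apply/andP; split.
  apply: addr_ge0; first by rewrite mulr_ge0// ltW.
  by rewrite mulr_ge0 ?divr_ge0// subr_ge0 ltW.
have h1 : (branch a w)%:R / M%:R * (1 - b) <= 1 * (1 - b).
  by rewrite ler_wpM2r// subr_ge0 ltW.
have h2 : b * x <= b * 1 by rewrite ler_wpM2l// ltW.
by lra.
Qed.

Lemma fibre_map_itv i x : (i <= M)%N -> 0 <= x <= 1 -> 0 <= fibre_map i x <= 1.
Proof.
move=> iM x01; have h0 : 0 <= (0 : R) < 1 by rewrite lexx ltr01.
rewrite -(gab_inv_branch x iM h0); apply: gab_itv => //.
by have /andP[] := inv_branch_itv iM h0.
Qed.

Definition fibre_lip (w : R) : R := if w < M%:R * a then b else M%:R.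

Lemma gab_lip w x y : `|gab M a b w x - gab M a b w y| <= fibre_lip w * `|x - y|.
Proof.
rewrite /gab /fibre_lip; case: ifP => _; last exact: tent_lip.
rewrite (_ : _ - _ = b * (x - y)); last by ring.
by rewrite normrM (gtr0_norm hb0).
Qed.

Lemma measurable_tent : measurable_fun setT tent.
Proof.
apply: continuous_measurable_fun => x; apply/cvgrPdist_lt => e e0.
near=> y; rewrite (le_lt_trans (tent_lip _ _))// -ltr_pdivlMl//.
by near: y; apply: (@cvgr_dist_lt _ _ _ _ _ id x) => //; rewrite mulr_gt0 ?invr_gt0.
Unshelve. all: by end_near. Qed.

Lemma measurable_fibre_map i : measurable_fun setT (fibre_map i).
Proof.
rewrite /fibre_map; case: (i < M)%N; last exact: measurable_tent.
by apply: measurable_funD => //; exact: measurable_funM.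
Qed.

Lemma measurable_branch : measurable_fun setT (fun w => (branch a w)%:R : R).
Proof.
apply: nondecreasing_measurable => // x y xy; rewrite ler_nat le_truncn//.
by rewrite ler_pM2r ?invr_gt0.
Qed.

Lemma measurable_fa : measurable_fun setT (fa M a).
Proof.
apply: measurable_fun_ifT.
- exact: measurable_fun_ltr.
- apply: measurable_funM => //; apply: measurable_funB => //.
  apply: measurable_funM => //; exact: measurable_branch.
- by apply: measurable_funM => //; exact: measurable_funB.
Qed.

Lemma measurable_baker : measurable_fun setT (baker M a b).
Proof.
apply/measurable_fun_pairP; split => /=.
  exact: (measurableT_comp measurable_fa measurable_fst).
apply: measurable_fun_ifT => /=.
- apply: measurable_fun_ltr => //; exact: measurable_fst.
- apply: measurable_funD.
    by apply: measurable_funM => //; exact: measurable_snd.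
  apply: measurable_funM => //; apply: measurable_funM => //.
  by apply: (measurableT_comp measurable_branch); exact: measurable_fst.
- by apply: (measurableT_comp measurable_tent); exact: measurable_snd.
Qed.

End BakerMap.

(** * Averages over the unit interval *)

Section UnitInterval.
Context {R : realType}.
Notation lam := (@lebesgue_measure R).

(** Half-open, so that f maps each base interval exactly onto it and no end
    point needs a separate treatment. *)
Definition unitI : set R := `[0, 1[%classic.

Lemma unitIE x : unitI x = (0 <= x < 1) :> Prop.
Proof. by rewrite /unitI/= in_itv. Qed.

Lemma measurable_unitI : measurable (unitI : set (measurableTypeR R)).
Proof. exact: measurable_itv. Qed.

Lemma leb_unitI : lam unitI = 1%E.
Proof. by rewrite /unitI lebesgue_measure_itv/= lte_fin ltr01 oppr0 adde0. Qed.

Lemma measurable_affine (c p : R) :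
  measurable_fun setT (fun t : measurableTypeR R => c + p * t : measurableTypeR R).
Proof. by apply: measurable_funD => //; exact: measurable_funM. Qed.

(** Both sides are measures that agree on half-open intervals, and those
    determine Lebesgue measure. *)
Lemma lebesgue_affine (c p : R) (p0 : 0 < p) (A : set (measurableTypeR R)) : measurable A ->
  (lam A = p%:E * lam ((fun t : R => (c + p * t)%R) @^-1` A))%E.
Proof.
have mphi := measurable_affine c p.
pose phi : measurableTypeR R -> measurableTypeR R := fun t => c + p * t.
have p0' : 0 <= p by exact: ltW.
unshelve epose (pf := (pushforward lam phi : {measure set (measurableTypeR R) -> \bar R})).
  exact: mphi.
pose m : {measure set (measurableTypeR R) -> \bar R} := mscale (NngNum p0') pf.
move=> mA; rewrite -[RHS]/(m A); apply: lebesgue_measure_unique => // _ [[x y] _ <-] /=.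
rewrite /m /pf /mscale/= /pushforward.
have -> : phi @^-1` `]x, y] = `](x - c) / p, (y - c) / p]%classic.
  apply/seteqP; split => t /=; rewrite !in_itv/= ltr_pdivrMr// ler_pdivlMr//;
    by rewrite ltrBlDl lerBrDl mulrC.
rewrite !lebesgue_measure_itv/= !lte_fin ltr_pM2r ?invr_gt0// ltrD2r.
case: ifPn => _; last by rewrite mule0.
by rewrite -!EFinB -EFinM; congr EFin; field; exact: lt0r_neq0.
Qed.

Lemma integral_affine (c p : R) (H : R -> \bar R) : 0 < p ->
  measurable_fun setT H -> (forall x, c <= x < c + p -> (0 <= H x)%E) ->
  (\int[lam]_(x in `[c, (c + p)%R[) H x = p%:E * \int[lam]_(t in unitI) H (c + p * t)%R)%E.
Proof.
move=> p0 mH H0; have mphi := measurable_affine c p.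
pose phi : measurableTypeR R -> measurableTypeR R := fun t => c + p * t.
have p0' : 0 <= p by exact: ltW.
unshelve epose (pf := (pushforward lam phi : {measure set (measurableTypeR R) -> \bar R})).
  exact: mphi.
pose m : {measure set (measurableTypeR R) -> \bar R} := mscale (NngNum p0') pf.
rewrite (@eq_measure_integral _ _ _ _ m); last first.
  by move=> A mA _; rewrite /m /pf /mscale/= /pushforward/= (lebesgue_affine c p0).
have mH' : measurable_fun (`[c, c + p[ : set R) H by exact: measurable_funTS.
rewrite /m ge0_integral_mscale//=.
congr (_ * _)%E; rewrite ge0_integral_pushforward//=; last first.
  by move=> x; rewrite inE/= in_itv/=; exact: H0.
congr (integral lam _ _); apply/seteqP; split => t /=; rewrite unitIE in_itv/= lerDl ltrD2l;
  by rewrite pmulr_rge0// gtr_pMr.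
Qed.

Definition E (u : R -> R) : R := \int[lam]_(x in unitI) u x.

(** Such functions are integrable on [0, 1) and stable under every operation
    used below.  Measurability is required on the whole line, so that
    compositions raise no question of domain. *)
Definition bmeas (u : R -> R) : Prop :=
  measurable_fun setT u /\ exists B : R, forall x, unitI x -> `|u x| <= B.

Lemma bmeas_integrable u : bmeas u -> lam.-integrable unitI (EFin \o u).
Proof.
move=> [mu [B uB]]; apply: measurable_bounded_integrable => //.
- exact: measurable_unitI.
- by rewrite /= leb_unitI ltry.
- exact: measurable_funTS.
- exists B; split; first exact: num_real.
  by move=> y By x xD; rewrite /= (le_trans (uB _ xD))// ltW.
Qed.

Lemma bmeas_cst c : bmeas (fun=> c).
Proof. by split => //; exists `|c|. Qed.

Lemma bmeasD u v : bmeas u -> bmeas v -> bmeas (fun x => u x + v x).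
Proof.
move=> [mu [B uB]] [mv [C vC]]; split; first exact: measurable_funD.
exists (B + C) => x Dx; rewrite (le_trans (ler_normD _ _))// lerD ?uB ?vC//.
Qed.

Lemma bmeasM u v : bmeas u -> bmeas v -> bmeas (fun x => u x * v x).
Proof.
move=> [mu [B uB]] [mv [C vC]]; split; first exact: measurable_funM.
by exists (B * C) => x Dx; rewrite normrM ler_pM ?uB ?vC.
Qed.

Lemma bmeasZ c u : bmeas u -> bmeas (fun x => c * u x).
Proof. exact: (bmeasM (bmeas_cst c)). Qed.

Lemma bmeasB u v : bmeas u -> bmeas v -> bmeas (fun x => u x - v x).
Proof.
move=> bu bv; have := bmeasD bu (bmeasZ (-1) bv).
by congr bmeas; apply/funext => x; rewrite mulN1r.
Qed.

Lemma bmeas_sum n (u : 'I_n -> R -> R) : (forall i, bmeas (u i)) ->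
  bmeas (fun x => \sum_(i < n) u i x).
Proof.
elim: n u => [|n IH] u bu.
  by have := bmeas_cst 0; congr bmeas; apply/funext => x; rewrite big_ord0.
have := bmeasD (IH (fun i => u (widen_ord (leqnSn n) i)) (fun i => bu _)) (bu ord_max).
by congr bmeas; apply/funext => x; rewrite big_ord_recr.
Qed.

Lemma bmeas_norm u : bmeas u -> bmeas (fun x => `|u x|).
Proof.
move=> [mu [B uB]]; split; first exact: measurableT_comp.
by exists B => x Dx; rewrite normr_id uB.
Qed.

Lemma bmeas_comp u (phi : R -> R) : measurable_fun setT phi ->
  (forall x, unitI x -> unitI (phi x)) -> bmeas u -> bmeas (fun x => u (phi x)).
Proof.
move=> mphi phiD [mu [B uB]]; split; first exact: measurableT_comp.
by exists B => x Dx; exact/uB/phiD.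
Qed.

Lemma E_eq u v : (forall x, unitI x -> u x = v x) -> E u = E v.
Proof. by move=> uv; apply: eq_Rintegral => x; rewrite inE; exact: uv. Qed.

Lemma E_cst c : E (fun=> c) = c.
Proof.
rewrite /E Rintegral_cst; last exact: measurable_unitI.
by rewrite /= leb_unitI mulr1.
Qed.

Lemma ED u v : bmeas u -> bmeas v -> E (fun x => u x + v x) = E u + E v.
Proof. by move=> /bmeas_integrable bu /bmeas_integrable bv; apply: RintegralD => //;
  exact: measurable_unitI. Qed.

Lemma EB u v : bmeas u -> bmeas v -> E (fun x => u x - v x) = E u - E v.
Proof. by move=> /bmeas_integrable bu /bmeas_integrable bv; apply: RintegralB => //;
  exact: measurable_unitI. Qed.

Lemma EZ c u : bmeas u -> E (fun x => c * u x) = c * E u.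
Proof. by move=> /bmeas_integrable bu; apply: RintegralZl => //; exact: measurable_unitI. Qed.

Lemma E_sum n (u : 'I_n -> R -> R) : (forall i, bmeas (u i)) ->
  E (fun x => \sum_(i < n) u i x) = \sum_(i < n) E (u i).
Proof.
elim: n u => [|n IH] u bu.
  by rewrite big_ord0 -[RHS](E_cst 0); apply: E_eq => x _; rewrite big_ord0.
rewrite big_ord_recr -IH//= -ED//; last exact: bmeas_sum.
by apply: E_eq => x _; rewrite big_ord_recr.
Qed.

Lemma E_le u v : bmeas u -> bmeas v -> (forall x, unitI x -> u x <= v x) -> E u <= E v.
Proof. by move=> /bmeas_integrable bu /bmeas_integrable bv h; apply: le_Rintegral => //;
  exact: measurable_unitI. Qed.

Lemma E_norm u : bmeas u -> `|E u| <= E (fun x => `|u x|).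
Proof. by move=> /bmeas_integrable bu; apply: le_normr_Rintegral => //;
  exact: measurable_unitI. Qed.

(** The form in which pointwise estimates are used: two averages differ by at
    most the average of a bound on the difference. *)
Lemma E_dist u v w : bmeas u -> bmeas v -> bmeas w ->
  (forall x, unitI x -> `|u x - v x| <= w x) -> `|E u - E v| <= E w.
Proof.
move=> bu bv bw h; rewrite -EB// (le_trans (E_norm (bmeasB bu bv)))//.
by apply: E_le => //; apply: bmeas_norm; exact: bmeasB.
Qed.

Lemma E_bound u B : bmeas u -> (forall x, unitI x -> `|u x| <= B) -> `|E u| <= B.
Proof.
move=> bu uB; rewrite (le_trans (E_norm bu))// -[leRHS]E_cst.
by apply: E_le => //; [exact: bmeas_norm|exact: bmeas_cst].
Qed.

Lemma EFin_E u : bmeas u -> ((E u)%:E = \int[lam]_(x in unitI) (u x)%:E)%E.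
Proof.
move=> /bmeas_integrable bu; rewrite /E /Rintegral fineK//.
by apply: integrable_fin_num => //; exact: measurable_unitI.
Qed.

End UnitInterval.

(** * Almost sure summability and averages along the squares *)

Section Summable.
Context {R : realType}.
Notation lam := (@lebesgue_measure R).

Definition ae_unit (P : R -> Prop) : Prop := {ae lam, forall w, unitI w -> P w}.

(** By monotone convergence the sum of the series is integrable, hence finite
    almost everywhere.  This takes the place of the pair Chebyshev and
    Borel-Cantelli. *)
Lemma ae_summable (u : nat -> R -> R) (B : R) :
  (forall n, bmeas (u n)) -> (forall n w, unitI w -> 0 <= u n w) ->
  (forall n, \sum_(k < n) E (u k) <= B) ->
  ae_unit (fun w => cvgn (series (u ^~ w))).
Proof.
move=> bu u0 uB.
pose F w := (\sum_(n <oo) (u n w)%:E)%E.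
have mF : measurable_fun unitI F.
  apply: (@ge0_emeasurable_sum _ _ _ _ (fun n w => (u n w)%:E) xpredT).
    by move=> k x Dx _; rewrite lee_fin u0.
  by move=> k _; apply/measurable_EFinP/measurable_funTS; exact: (bu k).1.
have F0 w : unitI w -> (0 <= F w)%E.
  by move=> Dw; apply: nneseries_ge0 => n _ _; rewrite lee_fin u0.
have iF : (\int[lam]_(w in unitI) F w <= B%:E)%E.
  rewrite integral_nneseries//.
  - apply: lime_le.
      apply: is_cvg_nneseries => n _ _; apply: integral_ge0 => w Dw.
      by rewrite lee_fin u0.
    apply: nearW => n; rewrite big_mkord.
    under eq_bigr => k _ do rewrite -EFin_E//.
    by rewrite sumEFin lee_fin.
  - exact: measurable_unitI.
  - by move=> n; apply/measurable_EFinP/measurable_funTS; exact: (bu n).1.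
have FI : lam.-integrable unitI F.
  apply/integrableP; split => //.
  apply: le_lt_trans (ltry B); apply: le_trans iF; rewrite le_eqVlt; apply/orP; left.
  by apply/eqP/eq_integral => w; rewrite inE => Dw; rewrite gee0_abs// F0.
apply: filterS (integrable_ae measurable_unitI FI) => w wF Dw.
apply: nondecreasing_is_cvgn.
  move=> m n mn; rewrite /series/= -(subnKC mn) /index_iota !subn0 iotaD big_cat/=.
  by rewrite lerDl; apply: sumr_ge0 => k _; exact: u0.
exists (fine (F w)) => _ [n _ <-].
rewrite -lee_fin fineK ?wF// /series/= -sumEFin /F.
by apply: nneseries_lim_ge => k _; rewrite lee_fin u0.
Qed.

Lemma ae_unit_imp (P Q : R -> Prop) : (forall w, unitI w -> P w -> Q w) -> ae_unit P ->
  ae_unit Q.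
Proof.
move=> PQ [N [mN N0 sN]]; exists N; split => //; apply: subset_trans sN.
by apply: subsetC => w Pw Dw; apply: PQ => //; exact: Pw.
Qed.

Lemma ae_unit_foralln (P : nat -> R -> Prop) :
  (forall n, ae_unit (P n)) -> ae_unit (fun w => forall n, P n w).
Proof.
move=> aP.
have [N [mN N0 sN]] := @ae_foralln _ _ _ (@lebesgue_measure R) (fun n w => unitI w -> P n w) aP.
by exists N; split => //; apply: subset_trans sN; apply: subsetC => w Pw Dw n; exact: Pw.
Qed.

Lemma ae_unit_and (P Q : R -> Prop) : ae_unit P -> ae_unit Q -> ae_unit (fun w => P w /\ Q w).
Proof.
move=> aP aQ.
have : ae_unit (fun w => forall n, (if n is 0%N then P else Q) w).
  by apply: ae_unit_foralln; case.
by apply: ae_unit_imp => w Dw h; split; [exact: (h 0%N)|exact: (h 1%N)].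
Qed.

End Summable.

(** The invariance of a measure on [0, 1]^2 is phrased with an intersection
    with the square; this removes the intersection. *)
Lemma prob_setI_full d (X : measurableType d) (R : realType) (P : probability X R)
    (S A : set X) :
  measurable S -> P S = 1%E -> measurable A -> P (S `&` A) = P A.
Proof.
move=> mS PS mA; have mC := measurableC mS.
have PC : P (~` S) = 0%E by rewrite probability_setC// PS subee.
rewrite [in RHS](_ : A = (S `&` A) `|` (~` S `&` A)); last first.
  by rewrite -setIUl setUv setTI.
rewrite measureU//.
- rewrite [X in _ = (_ + X)%E](_ : _ = 0%E) ?adde0//.
  by apply: (subset_measure0 _ _ _ PC) => //; exact: measurableI.
- exact: measurableI.
- exact: measurableI.
- by rewrite setIACA setICr set0I.
Qed.

Lemma half_bounds n : (n <= n./2.*2.+1)%N /\ (n <= (n - n./2).*2.+1)%N.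
Proof. by have := odd_double_half n; case: odd => /=; lia. Qed.

Section SquareSubsequence.
Context {R : realType}.

(** 1 / (k + 1)^2 <= 1 / k - 1 / (k + 1), which telescopes. *)
Lemma sum_inv_sqr n : \sum_(k < n) ((k.+1)%:R ^+ 2)^-1 <= 2 :> R.
Proof.
suff h m : \sum_(k < m.+1) ((k.+1)%:R ^+ 2)^-1 <= 2 - m.+1%:R^-1 :> R.
  case: n => [|n]; first by rewrite big_ord0.
  by rewrite (le_trans (h n))// gerBl invr_ge0.
elim: m => [|m IH]; first by rewrite big_ord1 expr1n invr1; lra.
rewrite big_ord_recr/= (le_trans (lerD IH (lexx _)))// -lerBrDr.
set x : R := m.+1%:R; have x0 : 0 < x by rewrite ltr0n.
have -> : m.+2%:R = x + 1 by rewrite natr1.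
suff : (x + 1) ^- 2 <= x^-1 - (x + 1)^-1.
  by move: (x^-1) ((x + 1)^-1) ((x + 1) ^- 2) => p q s; lra.
have -> : x^-1 - (x + 1)^-1 = (x * (x + 1))^-1.
  by field; rewrite !lt0r_neq0// addr_gt0.
rewrite lef_pV2 ?posrE ?mulr_gt0 ?exprn_gt0 ?addr_gt0//.
by rewrite expr2 ler_pM2r ?addr_gt0// lerDl.
Qed.

Lemma square_bracket n : (0 < n)%N -> exists k, (k.+1 ^ 2 <= n < k.+2 ^ 2)%N.
Proof.
elim: n => // -[_ _|n IH _]; first by exists 0%N.
have [//|k /andP[k1 k2]] := IH.
have [h|h] := ltnP n.+2 (k.+2 ^ 2); first by exists k; rewrite h andbT; lia.
by exists k.+1; rewrite h/=; nia.
Qed.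

(** Between two consecutive squares a sum of n bounded terms changes by
    O(sqrt n), which is negligible against n. *)
Lemma square_interpolation (x : nat -> R) (B : R) : (forall j, `|x j| <= B) ->
  (k.+1 ^ 2)%N%:R^-1 * \sum_(j < k.+1 ^ 2) x j @[k --> \oo] --> 0 ->
  n%:R^-1 * \sum_(j < n) x j @[n --> \oo] --> 0.
Proof.
move=> xB /cvgr0Pnorm_le h; apply/cvgr0Pnorm_le => e e0.
have B0 : 0 <= B by rewrite (le_trans _ (xB 0%N)).
have e2 : 0 < e / 2 by rewrite divr_gt0.
have [N _ hN] := h _ e2.
have [N' _ hN'] : \forall k \near \oo, B * 3 / (e / 2) <= k%:R by exact: nbhs_infty_ger.
exists ((N + N').+2 ^ 2)%N => // n /= nN.
have n0 : (0 < n)%N by rewrite (leq_trans _ nN).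
have [k /andP[k1 k2]] := square_bracket n0.
have kN : (N + N' <= k)%N.
  have : ((N + N').+2 ^ 2 < k.+2 ^ 2)%N by exact: leq_ltn_trans nN k2.
  by rewrite ltn_sqr => ?; lia.
have /(_ (leq_trans (leq_addr _ _) kN))/= h1 := hN k.
have /(_ (leq_trans (leq_addl _ _) kN))/= h2 := hN' k.
have n0R : 0 < n%:R :> R by rewrite ltr0n.
have k0R : 0 < (k.+1 ^ 2)%N%:R :> R by rewrite ltr0n.
rewrite normrM gtr0_norm ?invr_gt0// ler_pdivrMl//.
rewrite normrM gtr0_norm ?invr_gt0// ler_pdivrMl// in h1.
have -> : \sum_(j < n) x j = \sum_(j < k.+1 ^ 2) x j + \sum_(k.+1 ^ 2 <= j < n) x j.
  by rewrite -!(big_mkord xpredT) (big_cat_nat (leq0n (k.+1 ^ 2)%N) k1).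
rewrite (le_trans (ler_normD _ _))//.
have s2 : `|\sum_(k.+1 ^ 2 <= j < n) x j| <= B * (n - k.+1 ^ 2)%N%:R.
  rewrite (le_trans (ler_norm_sum _ _ _))// -mulr_natr.
  apply: (@le_trans _ _ (\sum_(k.+1 ^ 2 <= j < n) B)); first by apply: ler_sum.
  by rewrite sumr_const_nat mul1r mulr_natr.
have s3 : B * (n - k.+1 ^ 2)%N%:R <= (k.+1 ^ 2)%N%:R * (e / 2).
  apply: (@le_trans _ _ (B * (3 * k.+1%:R))).
    by rewrite ler_wpM2l// -natrM ler_nat; nia.
  rewrite expnS expn1 natrM -mulrA mulrA ler_pdivrMr// in h2 *.
  have : k%:R <= k.+1%:R :> R by rewrite ler_nat.
  have kp : 0 < k.+1%:R :> R by rewrite ltr0n.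
  move=> kk; rewrite -[leRHS]mulrA (_ : B * _ = k.+1%:R * (B * 3)); last by ring.
  rewrite ler_pM2l//.
  by rewrite (le_trans h2)// ler_wpM2r// ltW.
have s4 : (k.+1 ^ 2)%N%:R <= n%:R :> R by rewrite ler_nat.
have : (k.+1 ^ 2)%N%:R * (e / 2) <= n%:R * (e / 2) by rewrite ler_wpM2r// ltW.
by move: h1 s2 s3; lra.
Qed.

End SquareSubsequence.

(** * Piecewise affine approximation on the square *)

Section Grid.
Context {R : realType}.

Lemma sqE (p : plane R) : sq p = (0 <= p.1 <= 1 /\ 0 <= p.2 <= 1) :> Prop.
Proof. by rewrite /sq/= !in_itv. Qed.

Lemma unitI_sq (w x : R) : unitI w -> 0 <= x <= 1 -> sq (w, x).
Proof. by rewrite unitIE sqE/= => /andP[-> /ltW ->]. Qed.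

Lemma measurable_sq : measurable (sq : set (plane R)).
Proof. by apply: measurableX; exact: measurable_itv. Qed.

Lemma compact_sq : compact (sq : set (R * R)%type).
Proof. by apply: compact_setX; exact: segment_compact. Qed.

(** Heine-Cantor on the compact square, with a modulus of the form 1 / (N + 1)
    so that it is directly a mesh size. *)
Lemma uniformly_continuous_sq (phi : R * R -> R) (e : R) :
  {within sq, continuous phi} -> 0 < e ->
  exists N : nat, forall p q, sq p -> sq q ->
    `|p.1 - q.1| <= N.+1%:R^-1 -> `|p.2 - q.2| <= N.+1%:R^-1 -> `|phi p - phi q| <= e.
Proof.
move=> /subspace_continuousP cphi e0.
have /compact_near_coveringP/near_covering_withinP h := compact_sq.
pose P (N : nat) (p : R * R) := forall q, sq q ->
    `|p.1 - q.1| <= N.+1%:R^-1 -> `|p.2 - q.2| <= N.+1%:R^-1 -> `|phi p - phi q| <= e.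
have : \forall N \near \oo, sq `<=` P N.
  apply: h => x sx.
  have e2 : 0 < e / 2 by rewrite divr_gt0.
  have /cvgrPdist_lt/(_ _ e2) := cphi x sx.
  rewrite near_withinE => /nbhs_ballP[d /= d0 hd].
  have d2 : 0 < d / 2 by rewrite divr_gt0.
  near=> x' N => sx' q sq' h1 h2.
  have bx' : ball x (d / 2) x' by near: x'; exact: nbhsx_ballx.
  have Nd : N.+1%:R^-1 < d / 2 by near: N; exact: near_infty_natSinv_lt (PosNum d2).
  have hx' : `|phi x - phi x'| < e / 2.
    by apply: hd => //; apply: le_ball bx'; rewrite ler_pdivrMr// ler_peMr ?(ltW d0)// ler1n.
  have hq : `|phi x - phi q| < e / 2.
    apply: hd => //; move: bx' => [/= b1 b2].
    rewrite /ball/= in b1 b2; split; rewrite /ball/= [d]splitr.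
      by rewrite (le_lt_trans (ler_distD x'.1 _ _))// ltrD// (le_lt_trans _ Nd).
    by rewrite (le_lt_trans (ler_distD x'.2 _ _))// ltrD// (le_lt_trans _ Nd).
  rewrite [e]splitr (le_trans (ler_distD (phi x) _ _))// lerD//; last exact: ltW.
  by rewrite distrC ltW.
move=> [N _ hN]; exists N => p q sp sq'; exact: (hN N (leqnn N) p sp q sq').
Unshelve. all: by end_near. Qed.

Definition clamp (t : R) : R := Num.max 0 (Num.min 1 t).

Lemma clamp_itv t : 0 <= clamp t <= 1.
Proof. by rewrite /clamp le_max lexx/= ge_max ler01 ge_min lexx. Qed.

Lemma clamp_ge1 t : 1 <= t -> clamp t = 1.
Proof. by move=> t1; rewrite /clamp (min_idPl t1) (max_idPr ler01). Qed.

Lemma clamp_le0 t : t <= 0 -> clamp t = 0.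
Proof.
by move=> t0; rewrite /clamp (min_idPr (le_trans t0 ler01)) (max_idPl t0).
Qed.

Lemma le_clamp s t : s <= t -> clamp s <= clamp t.
Proof. by move=> st; rewrite /clamp le_max2 // le_min2. Qed.

Lemma clamp_lip s t : `|clamp s - clamp t| <= `|s - t|.
Proof.
wlog st : s t / s <= t.
  move=> h; have [st|/ltW ts] := leP s t; first exact: h.
  by rewrite distrC [leRHS]distrC; exact: h.
rewrite !ler0_norm ?subr_le0 ?le_clamp// !opprB.
have /andP[c0 c1] := clamp_itv t; have /andP[d0 d1] := clamp_itv s.
have [t0|t0] := leP t 0; first by rewrite (clamp_le0 t0); lra.
have [s1|s1] := leP 1 s; first by rewrite (clamp_ge1 s1); lra.
have tE : clamp t <= t by rewrite /clamp ge_max (ltW t0) ge_min lexx orbT.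
have sE : s <= clamp s by rewrite /clamp le_max le_min lexx (ltW s1) orbT.
by lra.
Qed.

(** Rises from 0 to 1 between (i - 1) / N and i / N.  The constant 1 for i = 0
    makes the differences of consecutive ramps telescope to 1 on [0, 1]. *)
Definition ramp (N i : nat) (t : R) : R := if i is i'.+1 then clamp (N%:R * t - i'%:R) else 1.

(** A continuous bump equal to 1 at i / N and vanishing outside the two
    adjacent cells. *)
Definition node_bump (N i : nat) (t : R) : R := ramp N i t - ramp N i.+1 t.

Lemma ramp_itv N i t : 0 <= ramp N i t <= 1.
Proof. by case: i => [|i] /=; [rewrite ler01 lexx|exact: clamp_itv]. Qed.

Lemma bump_itv N i t : 0 <= node_bump N i t <= 1.
Proof.
rewrite /node_bump; have /andP[h1 h2] := ramp_itv N i t; have /andP[h3 h4] := ramp_itv N i.+1 t.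
suff : ramp N i.+1 t <= ramp N i t by move=> ?; apply/andP; split; lra.
case: i {h1 h2 h3 h4} => [|i] /=; first by have /andP[] := clamp_itv (N%:R * t - 0%:R).
by apply: le_clamp; rewrite lerD2l lerN2 ler_nat.
Qed.

Lemma bump_far N i t : (0 < N)%N -> 0 <= t -> N%:R^-1 < `|t - i%:R / N%:R| ->
  node_bump N i t = 0.
Proof.
move=> N0 t0; have N0' : 0 < N%:R :> R by rewrite ltr0n.
have -> : t - i%:R / N%:R = (N%:R * t - i%:R) / N%:R by field; exact: lt0r_neq0.
rewrite normrM [`|N%:R^-1|]gtr0_norm ?invr_gt0// -[ltLHS]mul1r ltr_pM2r ?invr_gt0//.
rewrite lter_normr => /orP[h|h]; rewrite /node_bump.
  rewrite {2}/ramp (clamp_ge1 (ltW h)) /ramp; case: i h => [|i] h; first by rewrite subrr.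
  by rewrite clamp_ge1 ?subrr// (le_trans (ltW h))// lerD2l lerN2 ler_nat.
case: i h => [|i]; rewrite /ramp.
  by rewrite subr0 => h; exfalso; have := mulr_ge0 (ltW N0') t0; lra.
by rewrite -natr1 => h; rewrite !clamp_le0 ?subrr// -?natr1; lra.
Qed.

Lemma bump_sum N t : t <= 1 -> \sum_(i < N.+1) node_bump N i t = 1.
Proof.
move=> t1; rewrite /node_bump sumrB.
have tel (u : nat -> R) n : \sum_(i < n) u i - \sum_(i < n) u i.+1 = u 0%N - u n.
  elim: n => [|n IH]; first by rewrite !big_ord0 !subrr.
  by rewrite !big_ord_recr/= opprD addrACA IH addrA subrK.
rewrite (tel (fun i => ramp N i t)).
by rewrite /= clamp_le0 ?subr0// subr_le0 ler_piMr.
Qed.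

Lemma bump_lip N i s t : `|node_bump N i s - node_bump N i t| <= 2 * N%:R * `|s - t|.
Proof.
have h j : `|ramp N j s - ramp N j t| <= N%:R * `|s - t|.
  case: j => [|j] /=; first by rewrite subrr normr0 mulr_ge0.
  rewrite (le_trans (clamp_lip _ _))// opprB addrA subrK -mulrBr normrM.
  by rewrite ger0_norm.
rewrite /node_bump opprD addrACA -opprD (le_trans (ler_normB _ _))//.
by rewrite -mulrA mulr2n mulrDl mul1r lerD.
Qed.

Lemma measurable_bump N i : measurable_fun setT (node_bump N i).
Proof.
have mr j : measurable_fun setT (ramp N j).
  case: j => [|j] /=; first exact: measurable_cst.
  apply: measurable_maxr => //; apply: measurable_minr => //.
  by apply: measurable_funB => //; exact: measurable_funM.
exact: measurable_funB.
Qed.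

Definition tile (N i j : nat) (p : plane R) : R := node_bump N i p.1 * node_bump N j p.2.

Lemma measurable_tile N i j : measurable_fun setT (tile N i j).
Proof.
apply: measurable_funM.
  by apply: (measurableT_comp (measurable_bump N i)); exact: measurable_fst.
by apply: (measurableT_comp (measurable_bump N j)); exact: measurable_snd.
Qed.

Lemma tile_itv N i j p : 0 <= tile N i j p <= 1.
Proof.
have /andP[h1 h2] := bump_itv N i p.1; have /andP[h3 h4] := bump_itv N j p.2.
by rewrite mulr_ge0//= mulr_ile1.
Qed.

Lemma tile_lip N i j p q :
  `|tile N i j p - tile N i j q| <= 2 * N%:R * (`|p.1 - q.1| + `|p.2 - q.2|).
Proof.
rewrite /tile; set x := node_bump N i _; set y := node_bump N j _.
set x' := node_bump N i _; set y' := node_bump N j _.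
have -> : x * y - x' * y' = (x - x') * y + x' * (y - y') by ring.
apply: (le_trans (ler_normD _ _)); rewrite [leRHS]mulrDr [X in X + _]normrM [X in _ + X]normrM.
apply: lerD.
  rewrite -[leRHS]mulr1 ler_pM ?bump_lip//.
  by have /andP[? ?] := bump_itv N j p.2; rewrite ger0_norm.
rewrite -[leRHS]mul1r ler_pM ?bump_lip//.
by have /andP[? ?] := bump_itv N i q.1; rewrite ger0_norm.
Qed.

Definition grid (phi : plane R -> R) (N : nat) (p : plane R) : R :=
  \sum_(i < N.+1) \sum_(j < N.+1) phi (i%:R / N%:R, j%:R / N%:R) * tile N i j p.

Lemma measurable_grid phi N : measurable_fun setT (grid phi N).
Proof.
apply: measurable_sum => i; apply: measurable_sum => j.
by apply: measurable_funM => //; exact: measurable_tile.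
Qed.

Lemma sum_tile N p : sq p -> \sum_(i < N.+1) \sum_(j < N.+1) tile N i j p = 1.
Proof.
move=> [/=]; rewrite !in_itv/= => /andP[_ p1] /andP[_ p2].
rewrite -[RHS](bump_sum N p1); apply: eq_bigr => i _.
by rewrite -mulr_sumr bump_sum// mulr1.
Qed.

(** At a given point the bumps are nonnegative weights of sum 1, carried by
    nodes at distance at most the mesh. *)
Lemma grid_approx (phi : R * R -> R) (e : R) (N : nat) : 0 <= e ->
  (forall p q, sq p -> sq q ->
    `|p.1 - q.1| <= N.+1%:R^-1 -> `|p.2 - q.2| <= N.+1%:R^-1 -> `|phi p - phi q| <= e) ->
  forall p, sq p -> `|phi p - grid phi N.+1 p| <= e.
Proof.
move=> e0 h p sp.
have {1}-> : phi p = \sum_(i < N.+2) \sum_(j < N.+2) phi p * tile N.+1 i j p.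
  rewrite -[LHS]mulr1 -(sum_tile N.+1 sp) mulr_sumr; apply: eq_bigr => i _.
  by rewrite mulr_sumr.
have -> : e = \sum_(i < N.+2) \sum_(j < N.+2) e * tile N.+1 i j p.
  rewrite -[LHS]mulr1 -(sum_tile N.+1 sp) mulr_sumr; apply: eq_bigr => i _.
  by rewrite mulr_sumr.
rewrite /grid -sumrB (le_trans (ler_norm_sum _ _ _))//; apply: ler_sum => i _.
rewrite -sumrB (le_trans (ler_norm_sum _ _ _))//; apply: ler_sum => j _.
rewrite -mulrBl normrM; have /andP[t0 _] := tile_itv N.+1 i j p.
rewrite (ger0_norm t0).
have p10 : 0 <= p.1 by move: sp => [/=]; rewrite in_itv/= => /andP[].
have p20 : 0 <= p.2 by move: sp => [/= _]; rewrite in_itv/= => /andP[].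
have [h1|h1] := leP `|p.1 - i%:R / N.+1%:R| N.+1%:R^-1; last first.
  by rewrite /tile bump_far// mul0r !mulr0.
have [h2|h2] := leP `|p.2 - j%:R / N.+1%:R| N.+1%:R^-1; last first.
  by rewrite /tile [node_bump _ j _]bump_far// !mulr0.
apply: ler_wpM2r => //; apply: h => //.
by split; rewrite /= in_itv/= divr_ge0//= ler_pdivrMr// mul1r ler_nat -ltnS.
Qed.

End Grid.

(** * Monotonicity of plane Lebesgue measure on arbitrary sets *)

Section ProductNull.
Context {R : realType}.
Notation lam := (@lebesgue_measure R).

(** Arbitrary sets, because basins are not known to be measurable.  Lebesgue
    measure is defined on all of them as an outer measure, which is monotone. *)
Lemma le_lebesgue_measure (A B : set (measurableTypeR R)) : A `<=` B -> (lam A <= lam B)%E.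
Proof.
move=> AB; rewrite /lebesgue_measure /lebesgue_stieltjes_measure /measure_extension.
exact: le_mu_ext.
Qed.

(** The integral of a nonnegative function is the supremum of the integrals of
    the simple functions below it, so it is monotone without measurability;
    this carries [le_lebesgue_measure] over to the plane. *)
Lemma le_leb2 (A B : set (plane R)) : A `<=` B -> (@leb2 R A <= leb2 B)%E.
Proof.
move=> AB; rewrite /leb2 /product_measure1.
rewrite !ge0_integralTE//.
apply: ge_ereal_sup => _ [h hA <-]; apply: ereal_sup_ubound; exists h => //= x.
apply: (le_trans (hA x)); apply: le_lebesgue_measure.
by move=> y; rewrite /xsection/= !inE; exact: AB.
Qed.

Lemma leb2_setX (A B : set (measurableTypeR R)) : measurable A -> measurable B ->
  (leb2 (A `*` B) = lam A * lam B)%E.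
Proof. by move=> mA mB; rewrite /leb2 product_measure1E. Qed.

End ProductNull.

(** * Measures on the square determined by continuous functions *)

Section Determined.
Context {R : realType}.

(** The bound is a sum of coordinate distances, the form taken by all Lipschitz
    estimates below. *)
Lemma lipschitz_continuous_sq (phi : R * R -> R) (K : R) :
  (forall p q, sq p -> sq q -> `|phi p - phi q| <= K * (`|p.1 - q.1| + `|p.2 - q.2|)) ->
  {within sq, continuous phi}.
Proof.
move=> phiK; apply/subspace_continuousP => x sx; apply/cvgrPdist_lt => e e0.
pose K' := `|K| + 1; have K0 : 0 < K' by rewrite ltr_wpDl.
have d0 : 0 < e / K' / 2 by rewrite !divr_gt0.
rewrite near_withinE; near=> y => sy; rewrite (le_lt_trans (phiK _ _ sx sy))//.
have [/= b1 b2] : ball x (e / K' / 2) y by near: y; exact: nbhsx_ballx.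
rewrite /ball/= in b1 b2.
apply: (@le_lt_trans _ _ (K' * (`|x.1 - y.1| + `|x.2 - y.2|))).
  rewrite ler_wpM2r ?addr_ge0// (le_trans (ler_norm _))//.
  by rewrite /K' lerDl.
by rewrite mulrC -ltr_pdivlMr// [ltRHS]splitr ltrD.
Unshelve. all: by end_near. Qed.

(** Continuous, with values in [0, 1], and converging to the indicator of the
    open half-line u < 0. *)
Definition lstep (n : nat) (u : R) : R := clamp (- (n%:R * u)).

Lemma lstep_cvg u : lstep n u @[n --> \oo] --> ((u < 0)%R%:R : R).
Proof.
have [u0|u0] := ltP u 0; last first.
  rewrite (_ : lstep ^~ u = fun=> 0); first exact: cvg_cst.
  by apply/funext => n; rewrite /lstep clamp_le0// oppr_le0 mulr_ge0.
apply: cvg_near_cst; near=> n; rewrite /lstep clamp_ge1// -mulrN.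
rewrite -ler_pdivrMr ?oppr_gt0//; near: n; exact: nbhs_infty_ger.
Unshelve. all: by end_near. Qed.

Lemma lstep_itv n u : 0 <= lstep n u <= 1.
Proof. exact: clamp_itv. Qed.

Lemma lstep_lip n u v : `|lstep n u - lstep n v| <= n%:R * `|u - v|.
Proof.
rewrite (le_trans (clamp_lip _ _))// opprK addrC -mulrBr normrM ger0_norm//.
by rewrite distrC.
Qed.

Lemma measurable_lstep n : measurable_fun setT (lstep n).
Proof.
apply: measurable_maxr => //; apply: measurable_minr => //.
by apply: measurableT_comp => //; exact: measurable_funM.
Qed.

Definition corner (n : nat) (s t : R) (p : plane R) : R :=
  lstep n (p.1 - s) * lstep n (p.2 - t).

Lemma corner_itv n s t p : 0 <= corner n s t p <= 1.
Proof.
have /andP[h1 h2] := lstep_itv n (p.1 - s); have /andP[h3 h4] := lstep_itv n (p.2 - t).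
by rewrite mulr_ge0//= mulr_ile1.
Qed.

Lemma continuous_corner n s t : {within sq, continuous (corner n s t : R * R -> R)}.
Proof.
apply: (@lipschitz_continuous_sq _ n%:R) => p q _ _; rewrite /corner.
set x := lstep n _; set y := lstep n _; set x' := lstep n _; set y' := lstep n _.
have -> : x * y - x' * y' = (x - x') * y + x' * (y - y') by ring.
apply: (le_trans (ler_normD _ _)); rewrite [leRHS]mulrDr [X in X + _]normrM [X in _ + X]normrM.
apply: lerD.
  rewrite -[leRHS]mulr1 ler_pM//.
    by rewrite (le_trans (lstep_lip _ _ _))// opprB addrA subrK.
  by have /andP[? ?] := lstep_itv n (p.2 - t); rewrite ger0_norm.
rewrite -[leRHS]mul1r ler_pM//.
  by have /andP[? ?] := lstep_itv n (q.1 - s); rewrite ger0_norm.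
by rewrite (le_trans (lstep_lip _ _ _))// opprB addrA subrK.
Qed.

Lemma measurable_corner n s t : measurable_fun setT (corner n s t).
Proof.
by apply: measurable_funM; apply: (measurableT_comp (measurable_lstep n));
  exact: measurable_funB.
Qed.

Definition quadrant (s t : R) : set (plane R) := `]-oo, s[%classic `*` `]-oo, t[%classic.

Lemma measurable_quadrant s t : measurable (quadrant s t).
Proof. by apply: measurableX; exact: measurable_itv. Qed.

(** Dominated convergence: the corner functions tend pointwise to the indicator
    of the quadrant. *)
Lemma corner_integral_cvg (m : probability (plane R) R) s t : m sq = 1%E ->
  (\int[m]_(p in sq) (corner n s t p)%:E)%E @[n --> \oo] --> m (quadrant s t).
Proof.
move=> msq1; have msq : measurable (sq : set (plane R)) by exact: measurable_sq.
have mq := measurable_quadrant s t.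
have := @dominated_convergence _ _ _ m sq msq (fun n p => (corner n s t p)%:E)
  (fun p => (\1_(quadrant s t) p)%:E) (fun=> 1%E).
move=> /(_ _ _ _ _ _)/wrap[].
- by move=> n; apply/measurable_EFinP/measurable_funTS; exact: measurable_corner.
- by apply/measurable_EFinP; exact: measurable_indic.
- apply: aeW => p _; apply: cvg_EFin; first by apply: nearW.
  have := cvgM (@lstep_cvg (p.1 - s)) (@lstep_cvg (p.2 - t)).
  rewrite !subr_lt0 -natrM mulnb indicE (_ : p \in quadrant s t = (p.1 < s) && (p.2 < t)).
    exact.
  by apply/idP/idP; rewrite inE /quadrant/= !in_itv/= => /andP.
- by apply: finite_measure_integrable_cst.
- apply: aeW => p n _; rewrite gee0_abs ?lee_fin; by have /andP[] := corner_itv n s t p.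
move=> [_ _ h]; have := integral_indic m msq mq.
move=> e; rewrite -(prob_setI_full msq msq1 mq).
by rewrite (_ : sq `&` quadrant s t = quadrant s t `&` sq) -?e//; exact: setIC.
Qed.

Lemma quadrant_determined (m1 m2 : probability (plane R) R) : m1 sq = 1%E -> m2 sq = 1%E ->
  (forall phi : R * R -> R, {within sq, continuous phi} ->
    \int[m1]_(p in sq) phi p = \int[m2]_(p in sq) phi p) ->
  forall s t, m1 (quadrant s t) = m2 (quadrant s t).
Proof.
move=> h1 h2 h s t.
have c1 := @corner_integral_cvg m1 s t h1; have c2 := @corner_integral_cvg m2 s t h2.
have intE (m : probability (plane R) R) n :
    (\int[m]_(p in sq) (corner n s t p)%:E)%E = (\int[m]_(p in sq) corner n s t p)%:E.
  rewrite /Rintegral fineK//; apply: integrable_fin_num; first exact: measurable_sq.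
  apply: measurable_bounded_integrable.
  - exact: measurable_sq.
  - exact: le_lt_trans (probability_le1 _ (measurable_sq)) (ltry _).
  - by apply: measurable_funTS; exact: measurable_corner.
  - exists 1; split => // y y1 p _ /=; have /andP[c0 c1'] := corner_itv n s t p.
    by rewrite ger0_norm// (le_trans c1')// ltW.
rewrite -(cvg_lim _ c1)// -(cvg_lim _ c2)//; congr (limn _); apply/funext => n.
by rewrite !intE h//; exact: continuous_corner.
Qed.

(** Open rays form a pi-system that generates the Borel sets of the line. *)
Lemma ray_determined (n1 n2 : {measure set (measurableTypeR R) -> \bar R}) :
  (n1 setT < +oo)%E -> (forall s, n1 `]-oo, s[%classic = n2 `]-oo, s[%classic) ->
  forall A, measurable A -> n1 A = n2 A.
Proof.
move=> n1oo h A mA.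
apply: (@measure_unique _ R (measurableTypeR R) (@RGenInftyO.G R)
  (fun n : nat => `]-oo, (n%:R : R)[%classic) _ _ _ _ n1 n2 _ _ A mA).
- exact: RGenInftyO.measurableE.
- move=> _ _ [x ->] [y ->]; exists (Num.min x y); apply/seteqP; split => z /=;
    by rewrite !in_itv/= lt_min => /andP.
- by move=> n; exists n%:R.
- apply/seteqP; split => // x _; exists (Num.truncn `|x|).+1 => //=.
  by rewrite in_itv/= (le_lt_trans (ler_norm x))// truncnS_gt.
- by move=> _ [x ->]; exact: h.
- move=> k; apply: le_lt_trans n1oo; apply: le_measure; rewrite ?inE//.
Qed.

(** Continuous functions determine the masses of open quadrants.  One side of a
    rectangle at a time is then extended from rays to Borel sets, with
    the other side fixed, and rectangles generate the product sigma-algebra. *)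
Lemma determined_by_continuous (m1 m2 : probability (plane R) R) : m1 sq = 1%E -> m2 sq = 1%E ->
  (forall phi : R * R -> R, {within sq, continuous phi} ->
    \int[m1]_(p in sq) phi p = \int[m2]_(p in sq) phi p) ->
  forall A, measurable A -> m1 A = m2 A.
Proof.
move=> h1 h2 h.
have hq := quadrant_determined h1 h2 h.
have fstI (m : probability (plane R) R) B : measurable B ->
    exists2 n : {measure set (measurableTypeR R) -> \bar R}, (n setT < +oo)%E &
      forall A, n A = m (A `*` B).
  move=> mB; have mTB : measurable (setT `*` B : set (plane R)) by exact: measurableX.
  unshelve eexists (pushforward (mrestr m mTB) fst :
    {measure set (measurableTypeR R) -> \bar R}).
    exact: measurable_fst.
  - rewrite /= /pushforward /mrestr; apply: le_lt_trans (ltry 1).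
    by apply: probability_le1; rewrite preimage_setT setTI.
  - move=> A; rewrite /= /pushforward /mrestr; congr (m _).
    by apply/seteqP; split => [[x y] /= [? []]|[x y] /= []].
have sndI (m : probability (plane R) R) A : measurable A ->
    exists2 n : {measure set (measurableTypeR R) -> \bar R}, (n setT < +oo)%E &
      forall B, n B = m (A `*` B).
  move=> mA; have mTA : measurable (A `*` setT : set (plane R)) by exact: measurableX.
  unshelve eexists (pushforward (mrestr m mTA) snd :
    {measure set (measurableTypeR R) -> \bar R}).
    exact: measurable_snd.
  - rewrite /= /pushforward /mrestr; apply: le_lt_trans (ltry 1).
    by apply: probability_le1; rewrite preimage_setT setTI.
  - move=> B; rewrite /= /pushforward /mrestr; congr (m _).
    by apply/seteqP; split => [[x y] /= [? []]|[x y] /= []].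
have mray s : measurable (`]-oo, s[%classic : set (measurableTypeR R)) by exact: measurable_itv.
have e1 A t : measurable A -> m1 (A `*` `]-oo, t[%classic) = m2 (A `*` `]-oo, t[%classic).
  move=> mA; have [n1 n1oo n1E] := fstI m1 _ (mray t); have [n2 _ n2E] := fstI m2 _ (mray t).
  rewrite -n1E -n2E; apply: ray_determined => // s.
  by rewrite n1E n2E; exact: hq.
have e2 A B : measurable A -> measurable B -> m1 (A `*` B) = m2 (A `*` B).
  move=> mA mB; have [n1 n1oo n1E] := sndI m1 _ mA; have [n2 _ n2E] := sndI m2 _ mA.
  rewrite -n1E -n2E; apply: ray_determined => // s.
  by rewrite n1E n2E; exact: e1.
move=> A mA.
apply: (@measure_unique _ R (plane R) [set X `*` Y | X in measurable & Y in measurable]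
  (fun=> setT) _ _ _ _ m1 m2 _ _ A mA).
- exact: measurable_prod_measurableType.
- move=> _ _ [X1 mX1 [Y1 mY1 <-]] [X2 mX2 [Y2 mY2 <-]].
  exists (X1 `&` X2); first exact: measurableI.
  by exists (Y1 `&` Y2); [exact: measurableI|rewrite setXI].
- by move=> _; exists setT => //; exists setT => //; rewrite setXTT.
- by rewrite bigcup_const//; exists 0%N.
- by move=> _ [X mX [Y mY <-]]; exact: e2.
- by move=> _; apply: le_lt_trans (ltry 1); exact: probability_le1.
Qed.

End Determined.

(** * Lipschitz observables on the square *)

Section Lipschitz.
Context {R : realType}.

Lemma edist_le (p q : plane R) : Defs.edist p q <= `|p.1 - q.1| + `|p.2 - q.2|.
Proof.
rewrite /Defs.edist; move: (p.1 - q.1) (p.2 - q.2) => x y.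
have s0 : 0 <= `|x| + `|y| by rewrite addr_ge0.
rewrite -(ger0_norm s0) -sqrtr_sqr ler_sqrt ?sqr_ge0//.
rewrite sqrrD (real_normK (num_real x)) (real_normK (num_real y)) lerD2r lerDl.
by rewrite mulrn_wge0// mulr_ge0.
Qed.

Variables (phi : plane R -> R).
Hypothesis lphi : lipschitz_sq phi.

Lemma lipschitz_continuous : {within sq, continuous (phi : R * R -> R)}.
Proof.
have [K hK] := lphi; apply: (@lipschitz_continuous_sq _ _ `|K|) => p q sp sq'.
rewrite (le_trans (hK _ _ sp sq'))// (@le_trans _ _ (`|K| * Defs.edist p q))//.
  by rewrite ler_wpM2r ?sqrtr_ge0// ler_norm.
by rewrite ler_wpM2l// edist_le.
Qed.

Lemma sup_norm_ge (p : plane R) : sq p -> (exists B : R, forall q, sq q -> `|phi q| <= B) ->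
  `|phi p| <= sup_norm phi.
Proof.
move=> sp [B hB]; apply: ub_le_sup; last by exists p.
by exists B => _ [q sq' <-]; exact: hB.
Qed.

(** At pairs at distance 0 the quotient is 0 by the convention on division. *)
Lemma lip_const_ub : has_ubound [set r : R | exists p q,
    [/\ sq p, sq q, p <> q & r = `|phi p - phi q| / Defs.edist p q]].
Proof.
have [K hK] := lphi; exists `|K| => _ [p [q [sp sq' _ ->]]].
have [e0|e0] := eqVneq (Defs.edist p q) 0; first by rewrite e0 invr0 mulr0.
have e1 : 0 < Defs.edist p q by rewrite lt_neqAle eq_sym e0 sqrtr_ge0.
rewrite ler_pdivrMr// (le_trans (hK _ _ sp sq'))//.
by rewrite ler_pM2r// ler_norm.
Qed.

(** The supremum is over a nonempty set, (1, 0) and (0, 0) being distinct points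
    of the square. *)
Lemma lip_const_ge0 : 0 <= lip_const phi.
Proof.
have s0 : sq (0, 0 : R) by rewrite /sq/= !in_itv/= lexx ler01.
have s1 : sq (1, 0 : R) by rewrite /sq/= !in_itv/= !lexx ler01.
apply: (@le_trans _ _ (`|phi (1, 0) - phi (0, 0)| / Defs.edist (1, 0) (0, 0))).
  by rewrite divr_ge0// sqrtr_ge0.
apply: (ub_le_sup lip_const_ub); exists (1, 0), (0, 0); split => // -[] /eqP.
by rewrite oner_eq0.
Qed.

Lemma lip_constP (p q : plane R) : sq p -> sq q ->
  `|phi p - phi q| <= lip_const phi * (`|p.1 - q.1| + `|p.2 - q.2|).
Proof.
move=> sp sq'; apply: (@le_trans _ _ (lip_const phi * Defs.edist p q)); last first.
  by rewrite ler_wpM2l ?lip_const_ge0// edist_le.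
(* At distance 0 the defining inequality of a Lipschitz function gives equal
   values. *)
have [e0|e0] := eqVneq (Defs.edist p q) 0.
  by have [K hK] := lphi; have := hK _ _ sp sq'; rewrite e0 !mulr0.
have e1 : 0 < Defs.edist p q by rewrite lt_neqAle eq_sym e0 sqrtr_ge0.
rewrite -ler_pdivrMr//; apply: (ub_le_sup lip_const_ub); exists p, q; split => //.
move=> pq; move: e0; rewrite pq /Defs.edist !subrr expr0n/= addr0 sqrtr0.
by rewrite eqxx.
Qed.

End Lipschitz.

(** * Independence of the visited intervals *)

Section Transfer.
Context {R : realType}.
Notation lam := (@lebesgue_measure R).
Variables (M : nat) (a b : R).
Hypotheses (hM : (2 <= M)%N) (ha0 : 0 < a) (haM : a < 1 / M%:R).
Hypotheses (hb0 : 0 < b) (hb1 : b < 1).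
Local Notation branch_len := (branch_len M a).
Local Notation inv_branch := (inv_branch M a).
Local Notation f := (fa M a).

Lemma unitI_inv_branch i t : (i <= M)%N -> unitI t -> unitI (inv_branch i t).
Proof. by rewrite !unitIE => iM; exact: (inv_branch_itv hM ha0). Qed.

Lemma unitI_fa t : unitI t -> unitI (f t).
Proof. by rewrite !unitIE; exact: fa_itv. Qed.

Lemma measurable_inv_branch i : measurable_fun setT (inv_branch i : measurableTypeR R ->
  measurableTypeR R).
Proof. exact: measurable_affine. Qed.

Lemma ge0_integral_itv_cat (x y z : R) (H : R -> \bar R) : x <= y -> y <= z ->
  measurable_fun setT H -> (forall t, x <= t < z -> (0 <= H t)%E) ->
  (\int[lam]_(t in `[x, z[) H t =
   \int[lam]_(t in `[x, y[) H t + \int[lam]_(t in `[y, z[) H t)%E.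
Proof.
move=> xy yz mH H0; rewrite (@itv_bndbnd_setU _ _ (BLeft x) (BLeft y)) ?bnd_simp//.
rewrite ge0_integral_setU//=.
- exact: measurable_funTS.
- move=> t [] /=; rewrite in_itv/= => /andP[t1 t2]; apply: H0.
    by rewrite t1 (lt_le_trans t2).
  by rewrite t2 (le_trans xy).
- rewrite disj_set2E; apply/eqP; rewrite -subset0 => t [] /=.
  rewrite !in_itv/= => /andP[_ +] /andP[+ _].
  by move=> /lt_le_trans /[apply]; rewrite ltxx.
Qed.

(** [0, 1) is the disjoint union of the intervals of f, and the integral over
    each of them is rescaled to [0, 1).  This is the only property of Lebesgue
    measure on which the dynamics rests. *)
Lemma integral_split_branches (H : R -> \bar R) :
  measurable_fun setT H -> (forall t, unitI t -> (0 <= H t)%E) ->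
  (\int[lam]_(t in unitI) H t =
   \sum_(i < M.+1) (branch_len i)%:E * \int[lam]_(t in unitI) H (inv_branch i t))%E.
Proof.
move=> mH H0.
have Ma1 := ltW (Ma_lt1 hM haM).
have kE k : (k <= M)%N -> (\int[lam]_(t in `[0%R, (k%:R * a)%R[) H t =
   \sum_(i < k) a%:E * \int[lam]_(t in unitI) H (i%:R * a + a * t)%R)%E.
  elim: k => [|k IH] kM.
    by rewrite big_ord0 mul0r set_itvco0 integral_set0.
  have kM' : k.+1%:R * a <= 1.
    by rewrite (le_trans _ Ma1)// ler_pM2r// ler_nat.
  rewrite big_ord_recr/= -IH ?(ltnW kM)// -integral_affine//.
  - rewrite (@ge0_integral_itv_cat 0 (k%:R * a)).
    + by rewrite -natr1 mulrDl mul1r.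
    + by rewrite mulr_ge0// ltW.
    + by rewrite ler_pM2r// ler_nat.
    + by [].
    + move=> t /andP[t0 tk]; apply: H0; rewrite unitIE t0/=; exact: lt_le_trans tk kM'.
  - move=> t /andP[t0 tk]; apply: H0; rewrite unitIE; apply/andP; split.
      by rewrite (le_trans _ t0)// mulr_ge0// ltW.
    by apply: lt_le_trans kM'; rewrite -natr1 mulrDl mul1r.
have p0 : 0 < 1 - M%:R * a by rewrite subr_gt0 Ma_lt1.
have topE : (\int[lam]_(t in `[(M%:R * a)%R, 1%R[) H t =
  (1 - M%:R * a)%:E * \int[lam]_(t in unitI) H (M%:R * a + (1 - M%:R * a) * t)%R)%E.
  rewrite -integral_affine//.
  - by rewrite subrKC.
  - move=> t; rewrite subrKC => /andP[t0 t1]; apply: H0; rewrite unitIE t1 andbT.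
    by rewrite (le_trans _ t0)// mulr_ge0// ltW.
rewrite (@ge0_integral_itv_cat 0 (M%:R * a) 1)//.
- rewrite kE// topE big_ord_recr/=; congr (_ + _)%E.
    apply: eq_bigr => i _; rewrite /branch_len ltn_ord; congr (_ * _)%E.
    by apply: eq_integral => t _; rewrite /inv_branch /branch_len ltn_ord.
  rewrite /branch_len ltnn; congr (_ * _)%E.
  by apply: eq_integral => t _; rewrite /inv_branch /branch_len ltnn.
- by rewrite mulr_ge0// ltW.
Qed.

Lemma bmeas_inv_branch i u : (i <= M)%N -> bmeas u -> bmeas (fun t => u (inv_branch i t)).
Proof.
by move=> iM; apply: bmeas_comp; [exact: measurable_inv_branch|move=> x;
  exact: unitI_inv_branch].
Qed.

Lemma bmeas_fa u : bmeas u -> bmeas (fun t => u (f t)).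
Proof. by apply: bmeas_comp; [exact: measurable_fa|exact: unitI_fa]. Qed.

Lemma E_split (u : R -> R) : bmeas u ->
  E u = \sum_(i < M.+1) branch_len i * E (fun t => u (inv_branch i t)).
Proof.
move=> bu; have [mu [B uB]] := bu.
pose v x := u x + B; have bv : bmeas v := bmeasD bu (bmeas_cst B).
suff vE : E v = \sum_(i < M.+1) branch_len i * E (fun t => v (inv_branch i t)).
  move: vE; rewrite ED// ?E_cst; last exact: bmeas_cst.
  rewrite (eq_bigr (fun i : 'I_M.+1 => branch_len i * E (fun t =>
    u (inv_branch i t)) + branch_len i * B)).
    by rewrite big_split/= -mulr_suml branch_len_sum1// mul1r => /addIr.
  move=> i _; rewrite -mulrDr ED ?E_cst//; last exact: bmeas_cst.
  by apply: bmeas_inv_branch => //; rewrite -ltnS.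
apply: EFin_inj; rewrite EFin_E// integral_split_branches.
- rewrite -sumEFin; apply: eq_bigr => i _; rewrite EFinM; congr (_ * _)%E.
  by rewrite EFin_E//; apply: bmeas_inv_branch => //; rewrite -ltnS.
- apply/measurable_EFinP; exact: bv.1.
- move=> t Dt; rewrite lee_fin /v -lerBlDr sub0r.
  by have := uB _ Dt; rewrite ler_norml => /andP[].
Qed.

(** The duality between composition with f and the transfer operator of f,
    u |-> sum of branch_len i * (u o inv_branch i). *)
Lemma E_transfer u v : bmeas u -> bmeas v ->
  E (fun w => u w * v (f w)) = E (fun t =>
    (\sum_(i < M.+1) branch_len i * u (inv_branch i t)) * v t).
Proof.
move=> bu bv; rewrite E_split; last by apply: bmeasM => //; exact: bmeas_fa.
have bui i : (i < M.+1)%N -> bmeas (fun t => u (inv_branch i t)) by move=> iM;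
  exact: bmeas_inv_branch.
under [RHS]E_eq => t Dt do rewrite mulr_suml.
rewrite E_sum => [|i]; last by apply: bmeasM => //; apply: bmeasZ; exact: bui.
apply: eq_bigr => i _; rewrite -EZ; last first.
  apply: bmeasM; first exact: bui.
  by apply: (@bmeas_inv_branch i (fun w => v (f w))); [rewrite -ltnS|exact: bmeas_fa].
by apply: E_eq => t; rewrite unitIE => Dt; rewrite fa_inv_branch ?mulrA// -ltnS.
Qed.

(** Invariance of Lebesgue measure under f: the transfer operator fixes the
    constant 1. *)
Lemma E_fa v : bmeas v -> E (fun w => v (f w)) = E v.
Proof.
move=> bv; transitivity (E (fun w => 1 * v (f w))).
  by apply: E_eq => t _; rewrite mul1r.
rewrite (E_transfer (bmeas_cst 1) bv); apply: E_eq => t _.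
by under eq_bigr do rewrite mulr1; rewrite branch_len_sum1// mul1r.
Qed.

End Transfer.

(** * Contraction on average, and mixing of the base map *)

Section Exponent.
Context {R : realType}.

Lemma itv_dist (x y : R) : 0 <= x <= 1 -> 0 <= y <= 1 -> `|x - y| <= 1.
Proof. by move=> /andP[? ?] /andP[? ?]; rewrite ler_norml; lra. Qed.

Lemma le_self_powR (th d : R) : th <= 1 -> 0 <= d <= 1 -> d <= d `^ th.
Proof.
move=> th1 /andP[d0 d1]; have [->|dn0] := eqVneq d 0; first by rewrite powR_ge0.
by rewrite -[leLHS]powRr1// ger_powR// d1 andbT lt_neqAle eq_sym dn0.
Qed.

Lemma powR_le1 (th d : R) : 0 <= th -> 0 <= d <= 1 -> d `^ th <= 1.
Proof.
move=> th0 /andP[d0 d1]; have <- : (1 : R) `^ th = 1 by rewrite powR1.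
by apply: ge0_ler_powR; rewrite ?nnegrE.
Qed.

(** From exp (- u) >= 1 - u one gets exp u <= 1 / (1 - u). *)
Lemma expR_le_quad (u : R) : u <= 2^-1 -> expR u <= 1 + u + 2 * u ^+ 2.
Proof.
move=> u2; have h1 : 0 < 1 - u by lra.
have h2 : expR u <= (1 - u)^-1.
  rewrite -[u in expR u]opprK expRN lef_pV2 ?posrE ?expR_gt0//.
  exact: expR_ge1Dx.
apply: (le_trans h2); rewrite -[leLHS]mul1r ler_pdivrMr//.
have : 0 <= u ^+ 2 * (1 - 2 * u) by rewrite mulr_ge0 ?sqr_ge0//; lra.
by move=> ?; nra.
Qed.

(** The left-hand side equals 1 at th = 0 and has there the derivative
    m = q beta + (1 - q) gamma, which is negative; so it is below 1 for small th.
    The proof takes th = - m / (4 Q^2) with Q a bound on |beta| and |gamma| and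
    uses the quadratic bound on the exponential. *)
Lemma contraction_exponent (q beta gamma : R) : 0 <= q <= 1 ->
  q * beta + (1 - q) * gamma < 0 ->
  exists2 th : R, 0 < th <= 1 & q * expR (th * beta) + (1 - q) * expR (th * gamma) < 1.
Proof.
move=> /andP[q0 q1] m0; set m := (X in X < 0) in m0.
(* The leading 1 only keeps Q away from 0. *)
pose Q := 1 + `|beta| + `|gamma|.
have Q1 : 1 <= Q by rewrite /Q -addrA lerDl addr_ge0.
have Q0 : 0 < Q by rewrite (lt_le_trans _ Q1).
have bQ : `|beta| <= Q by rewrite /Q; have := normr_ge0 beta; have := normr_ge0 gamma; lra.
have gQ : `|gamma| <= Q by rewrite /Q; have := normr_ge0 beta; have := normr_ge0 gamma; lra.
have sqQ x : `|x| <= Q -> x ^+ 2 <= Q ^+ 2.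
  by move=> xQ; rewrite -real_normK ?num_real// lerXn2r ?nnegrE// ltW.
have mQ : - m <= Q.
  have : q * - beta + (1 - q) * - gamma <= q * Q + (1 - q) * Q.
    apply: lerD; apply: ler_wpM2l; rewrite ?subr_ge0//.
      by rewrite (le_trans (ler_norm _))// normrN.
    by rewrite (le_trans (ler_norm _))// normrN.
  by rewrite /m => h; lra.
pose th := - m / (4 * Q ^+ 2).
have Q2 : 0 < Q ^+ 2 by rewrite exprn_gt0.
have th0 : 0 < th by rewrite divr_gt0 ?oppr_gt0// mulr_gt0.
have thQ : th * Q <= 4^-1.
  have -> : th * Q = 4^-1 * (- m / Q) by rewrite /th; field; exact: lt0r_neq0.
  by rewrite ler_piMr// ler_pdivrMr// mul1r.
exists th.
  rewrite th0/= (le_trans _ (le_trans thQ _))//; last by lra.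
  by rewrite ler_peMr// ltW.
have thx x : `|x| <= Q -> th * x <= 2^-1.
  move=> xQ; rewrite (@le_trans _ _ (th * Q))//; last by lra.
  by rewrite ler_pM2l// (le_trans (ler_norm _)).
have e1 := expR_le_quad (thx _ bQ); have e2 := expR_le_quad (thx _ gQ).
have h : th ^+ 2 * Q ^+ 2 = th * - m / 4.
  by rewrite /th; field; exact: lt0r_neq0.
have f1 : (th * beta) ^+ 2 <= th * - m / 4.
  by rewrite -h exprMn ler_pM2l ?exprn_gt0// sqQ.
have f2 : (th * gamma) ^+ 2 <= th * - m / 4.
  by rewrite -h exprMn ler_pM2l ?exprn_gt0// sqQ.
have e1' : expR (th * beta) <= 1 + th * beta - th * m / 2 by lra.
have e2' : expR (th * gamma) <= 1 + th * gamma - th * m / 2 by lra.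
have : q * expR (th * beta) + (1 - q) * expR (th * gamma) <=
  q * (1 + th * beta - th * m / 2) + (1 - q) * (1 + th * gamma - th * m / 2).
  by apply: lerD; apply: ler_wpM2l => //; rewrite subr_ge0.
move/le_lt_trans; apply.
have : th * m < 0 by rewrite pmulr_rlt0.
set L := (X in _ -> X < 1); have -> : L = 1 + th * m / 2; last by lra.
by rewrite /L /m; field.
Qed.

(** Taking logarithms, the hypothesis on b reads
    M a ln b + (1 - M a) ln M < 0; apply [contraction_exponent]. *)
Lemma contracting_on_average (M : nat) (a b : R) : (2 <= M)%N -> 0 < a -> a < 1 / M%:R ->
  0 < b -> b < M%:R `^ (1 - 1 / (M%:R * a)) ->
  b < 1 /\ exists2 th : R, 0 < th <= 1 &
    M%:R * a * b `^ th + (1 - M%:R * a) * M%:R `^ th < 1.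
Proof.
move=> hM a0 aM b0 bM.
have M0 : 0 < M%:R :> R by rewrite ltr0n (leq_trans _ hM).
have M1 : 1 < M%:R :> R by rewrite ltr1n.
have q0 : 0 < M%:R * a by rewrite mulr_gt0.
have q1 := Ma_lt1 hM aM.
have lnb : ln b < (1 - 1 / (M%:R * a)) * ln M%:R.
  by rewrite -ln_powR ltr_ln ?posrE// powR_gt0.
have lnM : 0 < ln (M%:R : R) by rewrite ln_gt0.
split.
  rewrite -ltr_ln ?posrE// ln1 (lt_trans lnb)// pmulr_llt0// subr_lt0.
  by rewrite ltr_pdivlMr// mul1r.
have [|| th th01 h] := @contraction_exponent (M%:R * a) (ln b) (ln M%:R).
- by rewrite (ltW q0) ltW.
- have -> : M%:R * a * ln b + (1 - M%:R * a) * ln M%:R =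
      M%:R * a * (ln b - (1 - 1 / (M%:R * a)) * ln M%:R).
    by field; rewrite !lt0r_neq0.
  by rewrite pmulr_rlt0// subr_lt0.
exists th => //; move: h; rewrite /powR !gt_eqF//; exact.
Qed.

End Exponent.

Section SkewProduct.
Context {R : realType}.
Variables (M : nat) (a b : R).
Hypotheses (hM : (2 <= M)%N) (ha0 : 0 < a) (haM : a < 1 / M%:R).
Hypotheses (hb0 : 0 < b) (hb1 : b < 1).
Local Notation branch_len := (branch_len M a).
Local Notation inv_branch := (inv_branch M a).
Local Notation f := (fa M a).
Local Notation g := (gab M a b).
Local Notation T := (baker M a b).

(** The sum of the squares of the lengths.  An inverse branch contracts by its
    length and has its length as weight in the transfer operator, so this is
    the factor by which that operator reduces Lipschitz constants. *)
Definition overlap : R := \sum_(i < M.+1) branch_len i ^+ 2.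

Lemma overlap_gt0 : 0 < overlap.
Proof.
rewrite /overlap big_ord_recr/= ltr_wpDl ?exprn_gt0 ?branch_len_gt0//.
by apply: sumr_ge0 => i _; rewrite sqr_ge0.
Qed.

Lemma overlap_lt1 : overlap < 1.
Proof.
rewrite -(branch_len_sum1 M a) /overlap !big_ord_recr/= ler_ltD//.
  by apply: ler_sum => i _; rewrite expr2 ler_piMr ?ltW ?branch_len_gt0 ?branch_len_lt1.
by rewrite expr2 gtr_pMr ?branch_len_gt0 ?branch_len_lt1.
Qed.

Lemma transfer_lip u K : (forall x y, unitI x -> unitI y -> `|u x - u y| <= K * `|x - y|) ->
  forall x y, unitI x -> unitI y ->
  `|(\sum_(i < M.+1) branch_len i * u (inv_branch i x)) - (\sum_(i < M.+1) branch_len i * u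
    (inv_branch i y))| <=
  K * overlap * `|x - y|.
Proof.
move=> uK x y Dx Dy; rewrite -sumrB (le_trans (ler_norm_sum _ _ _))//.
rewrite /overlap mulr_sumr mulr_suml; apply: ler_sum => i _.
have iM : (i <= M)%N by rewrite -ltnS.
have w0 := branch_len_gt0 hM ha0 haM i.
rewrite -mulrBr normrM (gtr0_norm w0).
have -> : K * branch_len i ^+ 2 * `|x - y| =
  branch_len i * (K * (branch_len i * `|x - y|)) by ring.
rewrite ler_pM2l//.
have := uK _ _ (unitI_inv_branch hM ha0 haM iM Dx) (unitI_inv_branch hM ha0 haM iM Dy).
move/le_trans; apply.
by rewrite /inv_branch opprD addrACA subrr add0r -mulrBr normrM (gtr0_norm w0).
Qed.

Lemma bmeas_iter u k : bmeas u -> bmeas (fun w => u (iter k f w)).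
Proof.
move=> bu; elim: k => [//|k IH].
by have := bmeas_fa hM ha0 haM IH; congr bmeas; apply/funext => w; rewrite -iterSr.
Qed.

Lemma E_iter u k : bmeas u -> E (fun w => u (iter k f w)) = E u.
Proof.
move=> bu; elim: k => [//|k IH].
rewrite -IH -(E_fa hM ha0 haM (bmeas_iter k bu)); congr E; apply/funext => w.
by rewrite -iterSr.
Qed.

(** Each composition with f is moved onto u as an application of the transfer
    operator.  This keeps the average of u and multiplies its Lipschitz
    constant by [overlap]; after k steps u is within K overlap^k of its average. *)
Lemma exact_mixing u v K B k : bmeas u -> bmeas v -> 0 <= K ->
  (forall x y, unitI x -> unitI y -> `|u x - u y| <= K * `|x - y|) ->
  (forall x, unitI x -> `|v x| <= B) ->
  `|E (fun w => u w * v (iter k f w)) - E u * E v| <= K * B * overlap ^+ k.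
Proof.
move=> + bv + + vB; elim: k u K => [|k IH] u K bu K0 uK.
  rewrite expr0 mulr1 -EZ// -EB; [|exact: bmeasM|exact: bmeasZ].
  apply: E_bound => [|x Dx /=]; first by apply: bmeasB; [exact: bmeasM|exact: bmeasZ].
  rewrite -mulrBl normrM ler_pM// ?vB// -[u x](E_cst (u x)) -EB//; last exact: bmeas_cst.
  apply: E_bound => [|y Dy]; first by apply: bmeasB => //; exact: bmeas_cst.
  rewrite (le_trans (uK _ _ Dx Dy))// ler_piMr//.
  by move: Dx Dy; rewrite !unitIE ler_norml => /andP[? ?] /andP[? ?]; lra.
have bLu : bmeas (fun t => \sum_(i < M.+1) branch_len i * u (inv_branch i t)).
  by apply: bmeas_sum => i; apply: bmeasZ; apply: bmeas_inv_branch => //; rewrite -ltnS.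
have bvk := bmeas_iter k bv.
under E_eq => w Dw do rewrite iterSr.
rewrite (E_transfer hM ha0 haM bu bvk).
have -> : E u = E (fun t => \sum_(i < M.+1) branch_len i * u (inv_branch i t)).
  rewrite (E_split hM ha0 haM bu) E_sum => [|i].
    by apply: eq_bigr => i _; rewrite EZ//; apply: bmeas_inv_branch => //; rewrite -ltnS.
  by apply: bmeasZ; apply: bmeas_inv_branch => //; rewrite -ltnS.
have := IH _ (K * overlap) bLu _ (transfer_lip uK).
rewrite mulr_ge0 ?(ltW overlap_gt0)// => /(_ isT) /le_trans; apply.
by rewrite exprS le_eqVlt (_ : _ * B * _ = K * B * (overlap * overlap ^+ k)) ?eqxx//; ring.
Qed.

(** * Synchronization of orbits in one fibre *)

Lemma sq_baker p : sq p -> sq (T p).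
Proof.
rewrite !sqE/= => -[h1 h2]; split; first exact: fa_itvc.
by apply: gab_itv => //; have /andP[] := h1.
Qed.

Lemma sq_iter n p : sq p -> sq (iter n T p).
Proof. by move=> sp; elim: n => //= n; exact: sq_baker. Qed.

Lemma iter_fst n (p : plane R) : (iter n T p).1 = iter n f p.1.
Proof. by elim: n => //= n ->. Qed.

Lemma unitI_iter n w : unitI w -> unitI (iter n f w).
Proof. by move=> Dw; elim: n => //= n; exact: unitI_fa. Qed.

Lemma measurable_iter n : measurable_fun setT (iter n T).
Proof.
elim: n => [|n IH] /=; first exact: measurable_id.
by apply: measurableT_comp IH; exact: measurable_baker.
Qed.

Lemma bmeas_section (Phi : plane R -> R) B x : measurable_fun setT Phi ->
  (forall p, sq p -> `|Phi p| <= B) -> 0 <= x <= 1 ->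
  bmeas (fun w => Phi (w, x)).
Proof.
move=> mPhi PhiB x01; split; last by exists B => w Dw; apply/PhiB/unitI_sq.
exact: (measurableT_comp mPhi (pair2_measurable x)).
Qed.

Variable th : R.
Hypotheses (th0 : 0 < th) (th1 : th <= 1).
Let r := M%:R * a * b `^ th + (1 - M%:R * a) * M%:R `^ th.

(** The product over j < n of the th-power of the Lipschitz constant of the
    fibre map over f^j w. *)
Fixpoint lip_cocycle n (w : R) : R :=
  if n is n'.+1 then fibre_lip M a b w `^ th * lip_cocycle n' (f w) else 1.

Lemma fibre_lip_gt0 w : 0 < fibre_lip M a b w.
Proof. by rewrite /fibre_lip; case: ifP => // _; rewrite ltr0n (leq_trans _ hM). Qed.

Lemma lip_cocycle_ge0 n w : 0 <= lip_cocycle n w.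
Proof. by elim: n w => [|n IH] w //=; rewrite mulr_ge0// powR_ge0. Qed.

Lemma bmeas_fibre_lip : bmeas (fun w => fibre_lip M a b w `^ th).
Proof.
split.
  apply: (measurableT_comp (measurable_powR th)).
  by apply: measurable_fun_ifT => //; exact: measurable_fun_ltr.
exists (b `^ th + M%:R `^ th) => w _; rewrite ger0_norm ?powR_ge0// /fibre_lip.
by case: ifP => _; rewrite ?lerDl ?lerDr powR_ge0.
Qed.

Lemma bmeas_lip_cocycle n : bmeas (lip_cocycle n).
Proof.
elim: n => [|n IH]; first exact: bmeas_cst.
apply: bmeasM; [exact: bmeas_fibre_lip|exact: bmeas_fa].
Qed.

(** The factors are independent with mean r: the transfer operator maps the
    first factor to the constant r. *)
Lemma E_lip_cocycle n : E (lip_cocycle n) = r ^+ n.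
Proof.
elim: n => [|n IH]; first by rewrite E_cst.
rewrite exprS -IH /= (E_transfer hM ha0 haM bmeas_fibre_lip (bmeas_lip_cocycle n)) -EZ;
  last exact: bmeas_lip_cocycle.
apply: E_eq => t; rewrite unitIE => Dt; congr (_ * _).
rewrite (sum_branch_len M a (fun i => fibre_lip M a b (inv_branch i t) `^ th)).
have /andP[t0 t1] := Dt.
rewrite /r /fibre_lip inv_branch_top//; congr (_ + _).
rewrite (eq_bigr (fun=> b `^ th)) => [|i _]; last first.
  by have [-> _] := inv_branch_symbol ha0 (ltn_ord i) Dt.
by rewrite big_const_ord iter_addr_0 -[b `^ th *+ M]mulr_natl mulrA [a * _]mulrC.
Qed.

(** The induction is on |x - y|^th and not on |x - y|, because it is the
    th-powers whose averages are under control; the start of the induction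
    uses that the fibre has diameter 1 and th <= 1. *)
Lemma synchronization n w x y : unitI w -> 0 <= x <= 1 -> 0 <= y <= 1 ->
  `|(iter n T (w, x)).2 - (iter n T (w, y)).2| <= lip_cocycle n w * `|x - y| `^ th.
Proof.
elim: n w x y => [|n IH] w x y Dw x01 y01.
  by rewrite /= mul1r le_self_powR// normr_ge0 itv_dist.
have w0 : 0 <= w by move: Dw; rewrite unitIE => /andP[].
rewrite !iterSr /=.
have gI z : 0 <= z <= 1 -> 0 <= g w z <= 1 by exact: gab_itv.
rewrite (le_trans (IH _ _ _ (unitI_fa hM ha0 haM Dw) (gI _ x01) (gI _ y01)))//.
rewrite [leRHS]mulrAC mulrC ler_wpM2r ?lip_cocycle_ge0//.
rewrite -powRM//; last by rewrite ltW// fibre_lip_gt0.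
rewrite ge0_ler_powR ?nnegrE ?mulr_ge0 ?(ltW th0) ?(ltW (fibre_lip_gt0 _))//.
by rewrite gab_lip.
Qed.

Lemma synchronization1 n w x y : unitI w -> 0 <= x <= 1 -> 0 <= y <= 1 ->
  `|(iter n T (w, x)).2 - (iter n T (w, y)).2| <= lip_cocycle n w.
Proof.
move=> Dw x01 y01; rewrite (le_trans (synchronization n Dw x01 y01))//.
by rewrite ler_piMr ?lip_cocycle_ge0// powR_le1 ?(ltW th0)// normr_ge0 itv_dist.
Qed.

(** * The limit of backward compositions *)

Hypothesis r1 : r < 1.

Lemma r_gt0 : 0 < r.
Proof.
rewrite addr_gt0// mulr_gt0 ?powR_gt0// ?subr_gt0 ?Ma_lt1// ?mulr_gt0//;
  by rewrite ltr0n (leq_trans _ hM).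
Qed.

(** Base points at which the distance bounds of [synchronization] are summable.
    The set of these points is invariant under f, which spares an exceptional
    set in the functional equation of [backward_limit]. *)
Definition contracting (w : R) : Prop := unitI w /\ cvgn (series (lip_cocycle ^~ w)).

Lemma ae_contracting : ae_unit contracting.
Proof.
have := @ae_summable R lip_cocycle (1 - r)^-1 bmeas_lip_cocycle (fun n w _ =>
  lip_cocycle_ge0 n w).
have h n : \sum_(k < n) E (lip_cocycle k) <= (1 - r)^-1.
  under eq_bigr do rewrite E_lip_cocycle.
  have r1' : 0 < 1 - r by rewrite subr_gt0.
  rewrite -[leRHS]mul1r ler_pdivlMr// mulrC.
  by rewrite -opprB mulNr -subrX1 opprB gerBl exprn_ge0// ltW// r_gt0.
by move=> /(_ h); apply: ae_unit_imp.
Qed.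

Lemma contracting_fa w : contracting w -> contracting (f w).
Proof.
move=> [Dw cw]; split; first exact: unitI_fa.
have l0 : fibre_lip M a b w `^ th != 0 by rewrite gt_eqF// powR_gt0// fibre_lip_gt0.
have -> : series (lip_cocycle ^~ (f w)) =
    (fun n => (fibre_lip M a b w `^ th)^-1 * (series (lip_cocycle ^~ w) n.+1 - 1)).
  apply/funext => n; rewrite /series/= !big_mkord big_ord_recl/= addrC addKr.
  by rewrite -mulr_sumr mulKf.
apply: is_cvgMr; apply: is_cvgB; last exact: is_cvg_cst.
apply/cvg_ex; exists (limn (series (lip_cocycle ^~ w))).
by rewrite (cvg_shiftS (series (lip_cocycle ^~ w))).
Qed.

(** The fibre maps over w, f w, ..., f^(n-1) w composed so that the one over w
    is applied last.  Unlike forward orbits, this sequence converges. *)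
Fixpoint backward n (w : R) : R := if n is n'.+1 then g w (backward n' (f w)) else 0.

Lemma backward_itv n w : unitI w -> 0 <= backward n w <= 1.
Proof.
elim: n w => [|n IH] w Dw /=; first by rewrite lexx ler01.
apply: gab_itv => //; first by move: Dw; rewrite unitIE => /andP[].
by apply: IH; exact: unitI_fa.
Qed.

(** Two consecutive terms differ by the innermost point only, so the contraction
    estimate along w, f w, ... applies. *)
Lemma backward_step n w : unitI w -> `|backward n.+1 w - backward n w| `^ th <= lip_cocycle n w.
Proof.
elim: n w => [|n IH] w Dw.
  rewrite [leRHS]/= powR_le1 ?(ltW th0)// normr_ge0/=.
  exact: (itv_dist (backward_itv 1 Dw) (backward_itv 0 Dw)).
have := IH _ (unitI_fa hM ha0 haM Dw).
rewrite -(ler_pM2l (_ : 0 < fibre_lip M a b w `^ th)); last by rewrite powR_gt0// fibre_lip_gt0.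
rewrite -powRM//; last exact/ltW/fibre_lip_gt0.
apply: le_trans; rewrite ge0_ler_powR ?nnegrE ?mulr_ge0 ?(ltW th0) ?(ltW (fibre_lip_gt0 _))//.
exact: gab_lip.
Qed.

Lemma contracting_backward w : contracting w -> cvgn (backward ^~ w).
Proof.
move=> [Dw cw].
suff : cvgn (series (telescope (backward ^~ w))).
  rewrite telescopeK => c.
  have -> : backward ^~ w = (fun n => (backward n w - backward 0 w) + backward 0 w).
    by apply/funext => n; rewrite subrK.
  by apply: is_cvgD => //; exact: is_cvg_cst.
apply: normed_cvg; apply: (series_le_cvg _ _ _ cw) => n /=.
- exact: normr_ge0.
- exact: lip_cocycle_ge0.
- rewrite /telescope/= (le_trans _ (backward_step n Dw))//.
  apply: le_self_powR => //; rewrite normr_ge0/=.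
  by apply: (itv_dist (backward_itv n.+1 Dw)); exact: backward_itv.
Qed.

Lemma measurable_gab_comp u : measurable_fun setT u ->
  measurable_fun setT (fun w => g w (u w)).
Proof.
move=> mu; have mT : measurable_fun setT T by exact: measurable_baker.
have : measurable_fun setT (fun w : measurableTypeR R => (w, u w) : plane R).
  by apply/measurable_fun_pairP; split; [exact: measurable_id|exact: mu].
by move/(measurableT_comp mT)/measurable_fun_pairP => [_ +].
Qed.

Lemma measurable_backward n : measurable_fun setT (backward n).
Proof.
elim: n => [|n IH] //=; apply: measurable_gab_comp.
by apply: measurableT_comp IH _; exact: measurable_fa.
Qed.

(** The upper limit is measurable without any knowledge of the set of
    convergence; truncating to [0, 1] keeps the values in the fibre off that
    set. *)
Definition backward_limit (w : R) : R :=
  Num.max 0 (Num.min 1 (((fun w => limn_sup (backward ^~ w)) \_ unitI) w)).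

Lemma backward_limit_itv w : 0 <= backward_limit w <= 1.
Proof. by rewrite /backward_limit le_max lexx/= ge_max ler01 ge_min lexx. Qed.

Lemma measurable_backward_limit : measurable_fun setT backward_limit.
Proof.
apply: measurable_maxr => //; apply: measurable_minr => //.
apply/(measurable_restrictT _ _).1; first exact: measurable_unitI.
apply: measurable_fun_limn_sup.
- by move=> w Dw; exists 1 => _ [n _ <-]; have /andP[] := backward_itv n Dw.
- by move=> w Dw; exists 0 => _ [n _ <-]; have /andP[] := backward_itv n Dw.
- by move=> n; apply: measurable_funTS; exact: measurable_backward.
Qed.

Lemma contracting_backward_limit w : contracting w ->
  backward n w @[n --> \oo] --> backward_limit w.
Proof.
move=> gw; have c := contracting_backward gw; have [Dw _] := gw.
rewrite /backward_limit patchE mem_set// cvg_limn_supE//.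
have l0 : 0 <= limn (backward ^~ w).
  by apply: limr_ge => //; apply: nearW => n; have /andP[] := backward_itv n Dw.
have l1 : limn (backward ^~ w) <= 1.
  by apply: limr_le => //; apply: nearW => n; have /andP[] := backward_itv n Dw.
by rewrite (min_idPr l1) (max_idPr l0).
Qed.

Lemma continuous_gab w : continuous (g w).
Proof.
move=> x; apply/cvgrPdist_lt => e e0; have l0 := fibre_lip_gt0 w.
near=> y; rewrite (le_lt_trans (gab_lip M a hb0 _ _ _))// -ltr_pdivlMl//.
by near: y; apply: (@cvgr_dist_lt _ _ _ _ _ id x) => //; rewrite mulr_gt0 ?invr_gt0.
Unshelve. all: by end_near. Qed.

(** Passing to the limit in [backward (n + 1) w = g w (backward n (f w))]. *)
Lemma backward_limit_equivariant w : contracting w ->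
  backward_limit w = g w (backward_limit (f w)).
Proof.
move=> gw; have c1 := contracting_backward_limit gw;
  have c2 := contracting_backward_limit (contracting_fa gw).
have c3 : backward n.+1 w @[n --> \oo] --> backward_limit w
  by rewrite (cvg_shiftS (backward ^~ w)).
have c4 : g w (backward n (f w)) @[n --> \oo] --> g w (backward_limit (f w)).
  by apply: continuous_cvg c2; exact: continuous_gab.
by rewrite -(cvg_lim _ c3)// -(cvg_lim _ c4).
Qed.

(** * The invariant measure *)

Notation lam := (@lebesgue_measure R).

Definition unif : probability (measurableTypeR R) R := uniform_prob (@ltr01 R).

Lemma measurable_backward_limitR :
  measurable_fun setT (backward_limit : measurableTypeR R -> measurableTypeR R).
Proof. exact: measurable_backward_limit. Qed.

Definition backward_limit_mfun : {mfun measurableTypeR R >-> measurableTypeR R} :=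
  HB.pack (backward_limit : measurableTypeR R -> measurableTypeR R)
    (isMeasurableFun.Build _ _ _ _ _ measurable_backward_limitR).

(** The law of the second coordinate in equilibrium. *)
Definition fibre_law : probability (measurableTypeR R) R := distribution unif
  backward_limit_mfun.

(** The product structure reflects that the second coordinate at time n depends
    on the intervals visited before n only, hence is independent of f^n w. *)
Definition phys_measure : probability (plane R) R := (unif \x fibre_law)%E.

Lemma integral_unif (H : R -> \bar R) : measurable_fun setT H -> (forall x, 0 <= H x)%E ->
  (\int[unif]_x H x = \int[lam]_(x in unitI) H x)%E.
Proof.
move=> mH H0; rewrite /unif integral_uniform// subr0 invr1 mul1e.
by rewrite -integral_itv_bndo_bndc//; exact: measurable_funTS.
Qed.

Definition slice_integral (F : plane R -> \bar R) (y : R) : \bar R :=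
  (\int[lam]_(w in unitI) F (w, y))%E.

Lemma slice_integralE F : measurable_fun setT F -> (forall p, 0 <= F p)%E ->
  slice_integral F = fubini_G unif F.
Proof.
move=> mF F0; apply/funext => y; rewrite /slice_integral /fubini_G integral_unif//.
exact: (measurableT_comp mF (pair2_measurable y)).
Qed.

Lemma measurable_slice_integral F : measurable_fun setT F -> (forall p, 0 <= F p)%E ->
  measurable_fun setT (slice_integral F).
Proof. by move=> mF F0; rewrite slice_integralE//; exact: measurable_fun_fubini_tonelli_G. Qed.

Lemma slice_integral_ge0 F y : (forall p, 0 <= F p)%E -> (0 <= slice_integral F y)%E.
Proof. by move=> F0; apply: integral_ge0. Qed.

Lemma phys_measure_tonelli F : measurable_fun setT F -> (forall p, 0 <= F p)%E ->
  (\int[phys_measure]_p F p = \int[lam]_(e in unitI) slice_integral F (backward_limit e))%E.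
Proof.
move=> mF F0; rewrite /phys_measure fubini_tonelli2// -slice_integralE//.
rewrite /fibre_law ge0_integral_distribution.
- rewrite integral_unif//=.
    by apply: measurableT_comp (measurable_backward_limit); exact: measurable_slice_integral.
  by move=> x; exact: slice_integral_ge0.
- exact: measurable_slice_integral.
- by move=> y; exact: slice_integral_ge0.
Qed.

(** Write h for [backward_limit].  Both sides equal the sum over i of branch_len i
    times the average over e of the slice integral of F at fibre_map i (h e).  On
    the left the splitting into intervals is applied to the base variable; on the
    right it is applied to e, after h e has been replaced by g e (h (f e)). *)
Lemma phys_measure_invariant_integral F : measurable_fun setT F -> (forall p, 0 <= F p)%E ->
  (\int[phys_measure]_p F (T p) = \int[phys_measure]_p F p)%E.
Proof.
move=> mF F0.
have mG := measurable_slice_integral mF F0.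
have G0 y := slice_integral_ge0 y F0.
have mT : measurable_fun setT T by exact: measurable_baker.
have mGf : measurable_fun setT (fun e => slice_integral F (g e (backward_limit (f e)))).
  apply: measurableT_comp mG _; apply: (@measurable_gab_comp (fun e => backward_limit (f e))).
  by apply: measurableT_comp (measurable_backward_limit) _; exact: measurable_fa.
have mGi i : measurable_fun setT (fun e =>
  slice_integral F (fibre_map M b i (backward_limit e))).
  apply: measurableT_comp mG _.
  by apply: measurableT_comp (measurable_backward_limit); exact: measurable_fibre_map.
rewrite (phys_measure_tonelli mF F0) (phys_measure_tonelli (measurableT_comp mF mT)) => [|p];
  last exact: F0.
transitivity (\sum_(i < M.+1) (branch_len i)%:E * \int[lam]_(e in unitI) slice_integral F
  (fibre_map M b i (backward_limit e)))%E.
  have step y : slice_integral (F \o T) y =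
    (\sum_(i < M.+1) (branch_len i)%:E * slice_integral F (fibre_map M b i y))%E.
    rewrite /slice_integral (@integral_split_branches R M a hM ha0 haM).
    - apply: eq_bigr => i _; congr (_ * _)%E.
      apply: eq_integral => t; rewrite inE unitIE => Dt.
      by rewrite /= /baker/= fa_inv_branch ?gab_inv_branch// -ltnS.
    - apply: (@measurableT_comp _ _ _ _ _ _ (F \o T) _ (fun w => (w, y))).
        exact: measurableT_comp.
      exact: (pair2_measurable y).
    - by move=> t _; exact: F0.
  under eq_integral => e De do rewrite step.
  rewrite ge0_integral_sum//=.
  - apply: eq_bigr => i _; rewrite ge0_integralZl//.
    + exact: measurable_unitI.
    + by apply: measurable_funTS; exact: mGi.
    + by rewrite lee_fin ltW// branch_len_gt0.
  - exact: measurable_unitI.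
  - by move=> i; apply: measurable_funTS; apply: measurable_funeM; exact: mGi.
  - by move=> i e _; rewrite mule_ge0// lee_fin ltW// branch_len_gt0.
symmetry; transitivity (\int[lam]_(e in unitI) slice_integral F (g e (backward_limit (f e))))%E.
  (* [backward_limit_equivariant] is available almost everywhere only. *)
  apply: ge0_ae_eq_integral => //.
  - exact: measurable_unitI.
  - by apply: measurable_funTS; apply: measurableT_comp (measurable_backward_limit).
  - by apply: measurable_funTS.
  - apply: ae_unit_imp ae_contracting => e De ge; by rewrite -backward_limit_equivariant.
rewrite (integral_split_branches hM ha0 haM mGf) => [|e _]; last exact: G0.
apply: eq_bigr => i _; congr (_ * _)%E; apply: eq_integral => t; rewrite inE unitIE => Dt.
by rewrite fa_inv_branch ?gab_inv_branch// -ltnS.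
Qed.

Lemma phys_measure_sq : phys_measure sq = 1%E.
Proof.
have msq : measurable (sq : set (plane R)) by exact: measurable_sq.
have int1 : (\int[lam]_(x in unitI) cst (1 : \bar R) x = 1)%E.
  by rewrite integral_cst; [rewrite /= leb_unitI mul1e|exact: measurable_unitI].
rewrite -[sq]setIT -integral_indic// phys_measure_tonelli//; last first.
  by apply/measurable_EFinP; exact: measurable_indic.
transitivity (\int[lam]_(e in unitI) (1 : \bar R))%E.
  apply: eq_integral => e _; rewrite /slice_integral.
  rewrite (@eq_integral _ _ _ _ _ (cst 1%E)).
    exact: int1.
  move=> w; rewrite inE => Dw; rewrite indicE mem_set//; apply: unitI_sq => //.
  exact: backward_limit_itv.
exact: int1.
Qed.

Lemma phys_measure_invariant : invariant_prob T phys_measure.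
Proof.
split; first exact: phys_measure_sq.
move=> A mA.
have msq : measurable (sq : set (plane R)) by exact: measurable_sq.
have mT : measurable_fun setT T by exact: measurable_baker.
have mTA : measurable (T @^-1` A) by rewrite -[X in measurable X]setTI; exact: mT.
rewrite (prob_setI_full msq phys_measure_sq mTA).
have mF : measurable_fun setT (fun p : plane R => (\1_A p)%:E : \bar R).
  by apply/measurable_EFinP; exact: measurable_indic.
have F0 (p : plane R) : (0 <= (\1_A p)%:E :> \bar R)%E by rewrite lee_fin.
have eT B : measurable B -> phys_measure B = (\int[phys_measure]_p (\1_B p)%:E)%E.
  by move=> mB; rewrite (integral_indic phys_measure measurableT mB) setIT.
rewrite (eT _ mA) (eT _ mTA) -(phys_measure_invariant_integral mF F0).
by apply: eq_integral => p _; rewrite !indicE; congr (_%:R%:E).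
Qed.

(** * Decay of correlations *)

Definition slice_mean (F : plane R -> R) (y : R) : R := E (fun w => F (w, y)).

(** The integral of F for the invariant measure (see [phys_measure_mean]),
    as an iterated average over [0, 1). *)
Definition mean (F : plane R -> R) : R := E (fun e => slice_mean F (backward_limit e)).
Definition bmeas_sq (F : plane R -> R) : Prop :=
  measurable_fun setT F /\ exists B : R, forall p, sq p -> `|F p| <= B.

Lemma bmeas_sq_section F x : bmeas_sq F -> 0 <= x <= 1 -> bmeas (fun w => F (w, x)).
Proof. by move=> [mF [B FB]] x01; exact: bmeas_section FB x01. Qed.

Lemma bmeas_sq_iter F n : bmeas_sq F -> bmeas_sq (fun p => F (iter n T p)).
Proof.
move=> [mF [B FB]]; split; first by apply: measurableT_comp => //; exact: measurable_iter.
by exists B => p sp; exact/FB/sq_iter.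
Qed.

Lemma bmeas_sqM F G : bmeas_sq F -> bmeas_sq G -> bmeas_sq (fun p => F p * G p).
Proof.
move=> [mF [B FB]] [mG [C GC]]; split; first exact: measurable_funM.
by exists (B * C) => p sp; rewrite normrM ler_pM ?FB ?GC.
Qed.

Lemma bmeas_sqD F G : bmeas_sq F -> bmeas_sq G -> bmeas_sq (fun p => F p + G p).
Proof.
move=> [mF [B FB]] [mG [C GC]]; split; first exact: measurable_funD.
by exists (B + C) => p sp; rewrite (le_trans (ler_normD _ _))// lerD ?FB ?GC.
Qed.

Lemma bmeas_sq_cst c : bmeas_sq (fun=> c).
Proof. by split => //; exists `|c|. Qed.

Section MeanIntegral.
Variables (F : plane R -> R) (B : R).
Hypotheses (mF : measurable_fun setT F) (FB : forall p, sq p -> `|F p| <= B).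
Let bF : bmeas_sq F. Proof. by split => //; exists B. Qed.

Lemma slice_integral_shift (G : plane R -> \bar R) y : (forall p, sq p -> G p = (F p + B)%:E) ->
  0 <= y <= 1 -> slice_integral G y = (slice_mean F y + B)%:E.
Proof.
move=> GF y01; have bs := bmeas_sq_section bF y01.
have b2 := bmeasD bs (bmeas_cst B).
rewrite /slice_mean -[B in RHS]E_cst -ED//; last exact: bmeas_cst.
rewrite EFin_E//; apply: eq_integral => w; rewrite inE => Dw.
by rewrite GF//; exact: unitI_sq.
Qed.

(** Adding the bound B makes a bounded function nonnegative on the square, so
    that the results for nonnegative integrands apply. *)
Definition shifted : plane R -> \bar R := (fun p => (F p + B)%:E) \_ sq.
Local Notation G0 := shifted.

Lemma measurable_shifted : measurable_fun setT G0.
Proof.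
apply/(measurable_restrictT _ _).1; first exact: measurable_sq.
by apply/measurable_EFinP/measurable_funTS; exact: measurable_funD.
Qed.

Lemma shifted_ge0 p : (0 <= G0 p)%E.
Proof.
rewrite /shifted patchE; case: ifPn => //; rewrite inE => sp; rewrite lee_fin.
by have := FB sp; rewrite ler_norml => /andP[h _]; lra.
Qed.

Lemma shiftedE p : sq p -> G0 p = (F p + B)%:E.
Proof. by move=> sp; rewrite /shifted patchE mem_set. Qed.

Lemma bmeas_slice_mean : bmeas (fun e => slice_mean F (backward_limit e)).
Proof.
split; last first.
  exists B => e De; apply: E_bound.
    exact/(bmeas_sq_section bF)/backward_limit_itv.
  by move=> w Dw; apply: FB; apply: unitI_sq => //; exact: backward_limit_itv.
have -> : (fun e => slice_mean F (backward_limit e)) = (fun e =>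
  fine (slice_integral G0 (backward_limit e)) - B).
  apply/funext => e; rewrite (slice_integral_shift shiftedE (backward_limit_itv e)) /=.
  by rewrite addrK.
apply: measurable_funB => //; apply: (measurableT_comp (fine_measurable measurableT)).
apply: (measurableT_comp (measurable_slice_integral measurable_shifted shifted_ge0)).
exact: measurable_backward_limit.
Qed.

Lemma phys_measure_tonelli_shift (G : plane R -> \bar R) : measurable_fun setT G ->
  (forall p, 0 <= G p)%E -> (forall p, sq p -> G p = (F p + B)%:E) ->
  (\int[phys_measure]_p G p = (mean F + B)%:E)%E.
Proof.
move=> mG Gge0 GF; rewrite (phys_measure_tonelli mG Gge0) /mean.
rewrite -[B in RHS]E_cst -ED; [|exact: bmeas_slice_mean|exact: bmeas_cst].
rewrite EFin_E; last by apply: bmeasD; [exact: bmeas_slice_mean|exact: bmeas_cst].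
by apply: eq_integral => e _; rewrite (slice_integral_shift GF (backward_limit_itv e)).
Qed.

Lemma phys_measure_mean : \int[phys_measure]_(p in sq) F p = mean F.
Proof.
have msq : measurable (sq : set (plane R)) by exact: measurable_sq.
have fsq : (phys_measure sq < +oo)%E by rewrite phys_measure_sq ltry.
have iF : phys_measure.-integrable sq (EFin \o F).
  apply: measurable_bounded_integrable => //; first exact: measurable_funTS.
  exists B; split; first exact: num_real.
  by move=> y By p sp; rewrite /= (le_trans (FB sp))// ltW.
have iB : phys_measure.-integrable sq (EFin \o (fun=> B)).
  apply: measurable_bounded_integrable => //; exists `|B|; split => // y By p _.
  by rewrite /= ltW.
have := RintegralD msq iF iB; rewrite Rintegral_cst//.
rewrite [fine (phys_measure sq)](_ : _ = 1) ?mulr1; last by rewrite phys_measure_sq.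
have -> : \int[phys_measure]_(p in sq) (F p + B) = mean F + B.
  rewrite /Rintegral integral_mkcond -[RHS]/(fine (_)%:E).
  rewrite -(phys_measure_tonelli_shift measurable_shifted shifted_ge0 shiftedE).
  by [].
by move=> /addIr.
Qed.

End MeanIntegral.

Lemma mean_invariant F : bmeas_sq F -> mean (fun p => F (T p)) = mean F.
Proof.
move=> bF; have [mF [B FB]] := bF.
have mT : measurable_fun setT T by exact: measurable_baker.
have h2 := phys_measure_invariant_integral (measurable_shifted B mF) (shifted_ge0 FB).
have FTB p : sq p -> `|F (T p)| <= B by move=> sp; exact/FB/sq_baker.
have : (\int[phys_measure]_p (shifted F B \o T) p = (mean (fun p => F (T p)) + B)%:E)%E.
  apply: (phys_measure_tonelli_shift (measurableT_comp mF mT) FTB).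
  - by apply: measurableT_comp mT; exact: measurable_shifted.
  - by move=> p; exact: shifted_ge0.
  - by move=> p sp; apply: shiftedE; exact: sq_baker.
have sh := shifted_ge0 FB.
rewrite [LHS]h2 (phys_measure_tonelli_shift mF FB (measurable_shifted B mF) sh (@shiftedE F B)).
move=> h; exact: (addIr B (esym (EFin_inj h))).
Qed.

Lemma mean_invariant_iter F n : bmeas_sq F -> mean (fun p => F (iter n T p)) = mean F.
Proof.
move=> bF; elim: n => [//|n IH]; rewrite -[RHS]IH.
rewrite -(mean_invariant (bmeas_sq_iter n bF)); congr mean; apply/funext => p.
by rewrite -iterSr.
Qed.

Lemma mean_bound F c B : bmeas_sq F -> (forall y, 0 <= y <= 1 -> `|slice_mean F y - c| <= B) ->
  `|mean F - c| <= B.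
Proof.
move=> [mF [C FC]] h; have bF := bmeas_slice_mean mF FC.
rewrite -[c](E_cst c) -EB//; last exact: bmeas_cst.
apply: E_bound => [|e _]; first by apply: bmeasB => //; exact: bmeas_cst.
exact/h/backward_limit_itv.
Qed.

(** Bounds B and Lipschitz constants K are carried along explicitly, since the
    final estimates must be uniform in the observable. *)
Definition obs (F : plane R -> R) (B K : R) : Prop :=
  [/\ measurable_fun setT F, forall p, sq p -> `|F p| <= B &
     forall p q, sq p -> sq q -> `|F p - F q| <= K * (`|p.1 - q.1| + `|p.2 - q.2|)].

Lemma obs_bmeas_sq F B K : obs F B K -> bmeas_sq F.
Proof. by move=> [mF FB _]; split => //; exists B. Qed.

Lemma sq0 : sq (0, 0 : R).
Proof. by rewrite sqE/= lexx ler01. Qed.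

Lemma obs_ge0 F B K : obs F B K -> 0 <= B /\ 0 <= K.
Proof.
move=> [_ FB FK]; split; first exact: le_trans (FB _ sq0).
have sq1 : sq (1, 0 : R) by rewrite sqE/= !lexx ler01.
have := FK (1, 0) (0, 0) sq1 sq0; rewrite /=.
by rewrite !subr0 normr1 normr0 addr0 mulr1; apply: le_trans.
Qed.

Lemma obs_synchronization F B K n w x y : obs F B K -> unitI w -> 0 <= x <= 1 -> 0 <= y <= 1 ->
  `|F (iter n T (w, x)) - F (iter n T (w, y))| <= K * lip_cocycle n w.
Proof.
move=> oF Dw x01 y01; have [_ K0] := obs_ge0 oF; have [_ _ FK] := oF.
rewrite (le_trans (FK _ _ (sq_iter _ _) (sq_iter _ _)))//; try exact: unitI_sq.
rewrite !iter_fst/= subrr normr0 add0r ler_wpM2l//.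
exact: synchronization1.
Qed.

(** By invariance the mean of F is an average of orbit averages started at
    heights [backward_limit e]; changing the starting height costs K r^m. *)
Lemma mean_of_orbit F B K m y : obs F B K -> 0 <= y <= 1 ->
  `|mean F - E (fun w => F (iter m T (w, y)))| <= K * r ^+ m.
Proof.
move=> oF y01; have bF := obs_bmeas_sq oF; have bFm := bmeas_sq_iter m bF.
rewrite -(mean_invariant_iter m bF); apply: mean_bound => // x x01.
rewrite -E_lip_cocycle -EZ; last exact: bmeas_lip_cocycle.
apply: E_dist.
- exact: (bmeas_sq_section bFm).
- exact: (bmeas_sq_section bFm).
- by apply: bmeasZ; exact: bmeas_lip_cocycle.
by move=> w Dw; exact: obs_synchronization oF Dw x01 y01.
Qed.

(** Three replacements: the height at time k by 0, at a cost of B K' r^m; the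
    average of the product by the product of averages, by [exact_mixing]; the
    orbit average of G started at height 0 by its mean. *)
Lemma decay_km F G B K B' K' k m x : obs F B K -> obs G B' K' -> 0 <= x <= 1 ->
  `|E (fun w => F (w, x) * G (iter (m + k) T (w, x))) - E (fun w => F (w, x)) * mean G| <=
  B * (K' * r ^+ m) + K * B' * overlap ^+ k + B * (K' * r ^+ m).
Proof.
move=> oF oG x01; have [B0 K0] := obs_ge0 oF; have [B'0 K'0] := obs_ge0 oG.
have [_ FB FK] := oF; have [_ GB GK] := oG.
have bu := bmeas_sq_section (obs_bmeas_sq oF) x01; set u := (fun w => F (w, x)) in bu *.
have z01 : 0 <= (0 : R) <= 1 by rewrite lexx ler01.
have bv := bmeas_sq_section (bmeas_sq_iter m (obs_bmeas_sq oG)) z01.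
set v := (fun w => G (iter m T (w, 0))) in bv.
have bvk := bmeas_iter k bv.
have bL := bmeas_iter k (bmeas_lip_cocycle m).
have uB w : unitI w -> `|u w| <= B by move=> Dw; exact/FB/unitI_sq.
have vB w : unitI w -> `|v w| <= B' by move=> Dw; exact/GB/sq_iter/unitI_sq.
have s1 : `|E (fun w => u w * G (iter (m + k) T (w, x))) - E (fun w => u w * v (iter k f w))|
    <= B * (K' * r ^+ m).
  rewrite -E_lip_cocycle -(E_iter k (bmeas_lip_cocycle m)) -!EZ//; last exact: bmeasZ.
  apply: E_dist.
  - by apply: bmeasM => //; exact: (bmeas_sq_section (bmeas_sq_iter (m + k) (obs_bmeas_sq
    oG)) x01).
  - exact: bmeasM.
  - by do 2 apply: bmeasZ.
  move=> w Dw; rewrite -mulrBr normrM ler_pM ?uB// iterD.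
  have := sq_iter k (unitI_sq Dw x01).
  rewrite [iter k T _]surjective_pairing iter_fst/= sqE/= => -[_ xk].
  by apply: (obs_synchronization m oG) => //; exact: unitI_iter.
have s2 := exact_mixing k bu bv K0 _ vB.
have {}s2 : `|E (fun w => u w * v (iter k f w)) - E u * E v| <= K * B' * overlap ^+ k.
  apply: s2 => y z Dy Dz; have := FK (y, x) (z, x) (unitI_sq Dy x01) (unitI_sq Dz x01).
  by rewrite /= subrr normr0 addr0.
have s3 : `|E u * E v - E u * mean G| <= B * (K' * r ^+ m).
  rewrite -mulrBr normrM ler_pM ?E_bound// distrC.
  exact: mean_of_orbit oG z01.
rewrite (le_trans (ler_distD (E u * E v) _ _))// lerD//.
by rewrite (le_trans (ler_distD (E (fun w => u w * v (iter k f w))) _ _))// lerD.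
Qed.

(** The square root accounts for the cut of n into two halves. *)
Definition rate : R := Num.sqrt (Num.max overlap r).

Lemma rate_gt0 : 0 < rate.
Proof. by rewrite sqrtr_gt0 lt_max overlap_gt0. Qed.

Lemma rate_lt1 : rate < 1.
Proof.
rewrite -sqrtr1 ltr_sqrt// gt_max r1 andbT.
exact: overlap_lt1.
Qed.

Lemma rate_half q n k : 0 <= q -> q <= Num.max overlap r -> (n <= k.*2.+1)%N ->
  q ^+ k <= rate ^+ n / rate.
Proof.
move=> q0 qm nk; rewrite ler_pdivlMr ?rate_gt0//.
have m0 : 0 <= Num.max overlap r by rewrite (le_trans q0).
apply: (@le_trans _ _ (rate ^+ k.*2.+1)).
  rewrite exprSr; apply: ler_wpM2r; first exact/ltW/rate_gt0.
  by rewrite -mul2n exprM sqr_sqrtr// lerXn2r ?nnegrE.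
by apply: ler_wiXn2l nk; apply: ltW; [exact: rate_gt0|exact: rate_lt1].
Qed.

Lemma decay_fixed F G B K B' K' n x : obs F B K -> obs G B' K' -> 0 <= x <= 1 ->
  `|E (fun w => F (w, x) * G (iter n T (w, x))) - E (fun w => F (w, x)) * mean G| <=
  3 / rate * ((B + K) * (B' + K')) * rate ^+ n.
Proof.
move=> oF oG x01; have [B0 K0] := obs_ge0 oF; have [B'0 K'0] := obs_ge0 oG.
have nE : n = (n - n./2 + n./2)%N.
  by rewrite subnK// -[leqRHS]odd_double_half -addnn addnA leq_addl.
have := decay_km n./2 (n - n./2) oF oG x01; rewrite -nE => /le_trans; apply.
set c := rate ^+ n / rate.
have c0 : 0 <= c by rewrite divr_ge0 ?exprn_ge0// ltW// rate_gt0.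
have h1 : r ^+ (n - n./2) <= c.
  apply: rate_half; [exact/ltW/r_gt0|by rewrite le_max lexx orbT|].
  exact: (half_bounds n).2.
have h2 : overlap ^+ n./2 <= c.
  apply: rate_half; [exact/ltW/overlap_gt0|by rewrite le_max lexx|].
  exact: (half_bounds n).1.
have -> : 3 / rate * ((B + K) * (B' + K')) * rate ^+ n =
  3 * ((B + K) * (B' + K') * c) by rewrite /c; ring.
have e1 : B * (K' * r ^+ (n - n./2)) <= (B + K) * (B' + K') * c.
  rewrite mulrA; apply: ler_pM => //; rewrite ?mulr_ge0 ?exprn_ge0//.
    exact/ltW/r_gt0.
  by apply: ler_pM; rewrite ?lerDl ?lerDr.
have e2 : K * B' * overlap ^+ n./2 <= (B + K) * (B' + K') * c.
  apply: ler_pM => //; rewrite ?mulr_ge0 ?exprn_ge0//.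
    exact/ltW/overlap_gt0.
  by apply: ler_pM; rewrite ?lerDl ?lerDr.
by lra.
Qed.

Lemma decay_mean F G B K B' K' n : obs F B K -> obs G B' K' ->
  `|mean (fun p => F p * G (iter n T p)) - mean F * mean G| <=
  3 / rate * ((B + K) * (B' + K')) * rate ^+ n.
Proof.
move=> oF oG; have bF := obs_bmeas_sq oF; have bG := bmeas_sq_iter n (obs_bmeas_sq oG).
have [mF [C FC]] := bF; have [mFG [C' FGC']] := bmeas_sqM bF bG.
have b1 := bmeas_slice_mean mF FC; have b2 := bmeas_slice_mean mFG FGC'.
rewrite mulrC -EZ// -EB//; last exact: bmeasZ.
apply: E_bound => [|e _]; first by apply: bmeasB => //; exact: bmeasZ.
by rewrite mulrC; apply: decay_fixed => //; exact: backward_limit_itv.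
Qed.

(** * Birkhoff averages of a Lipschitz observable *)

Section Birkhoff.
Variables (F : plane R -> R) (B K : R).
Hypothesis oF : obs F B K.

Definition centred p := F p - mean F.

Lemma mean_le : `|mean F| <= B.
Proof.
have [mF FB _] := oF; apply: E_bound; first exact: bmeas_slice_mean FB.
move=> e _; apply: E_bound; first exact: (bmeas_sq_section (obs_bmeas_sq oF)
  (backward_limit_itv e)).
by move=> w Dw; apply: FB; apply: unitI_sq => //; exact: backward_limit_itv.
Qed.

Lemma obs_centred : obs centred (B + B) K.
Proof.
have [mF FB FK] := oF; split.
- exact: measurable_funB.
- by move=> p sp; rewrite (le_trans (ler_normB _ _))// lerD ?FB// mean_le.
- move=> p q sp sq; rewrite /centred (_ : _ - _ = F p - F q); first exact: FK.
  by rewrite opprB addrA subrK.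
Qed.

Lemma mean_centred : mean centred = 0.
Proof.
have [mF FB _] := oF; rewrite -(subrr (mean F)).
rewrite -[X in _ = mean F - X]E_cst -[X in _ = X - _]/(E _) -EB; last 2 first.
- exact: bmeas_slice_mean FB.
- exact: bmeas_cst.
apply: E_eq => e _; rewrite /slice_mean -[X in _ = _ - X]E_cst -EB//; last exact: bmeas_cst.
exact: (bmeas_sq_section (obs_bmeas_sq oF) (backward_limit_itv e)).
Qed.

Definition birkhoff_sum n (p : plane R) := \sum_(j < n) centred (iter j T p).

Lemma bmeas_sq_birkhoff_sum n : bmeas_sq (birkhoff_sum n).
Proof.
elim: n => [|n IH].
  have := bmeas_sq_cst 0; congr bmeas_sq; apply/funext => p; by rewrite /birkhoff_sum big_ord0.
have := bmeas_sqD IH (bmeas_sq_iter n (obs_bmeas_sq obs_centred)); congr bmeas_sq;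
  apply/funext => p.
by rewrite /birkhoff_sum big_ord_recr.
Qed.

Lemma birkhoff_sumS n p : birkhoff_sum n.+1 p = centred p + birkhoff_sum n (T p).
Proof.
rewrite /birkhoff_sum big_ord_recl/=; congr (_ + _); apply: eq_bigr => i _.
by rewrite /bump/= -iterSr.
Qed.

Lemma E_baker H x : bmeas_sq H -> 0 <= x <= 1 ->
  E (fun w => H (T (w, x))) = \sum_(i < M.+1) branch_len i * E (fun t =>
    H (t, fibre_map M b i x)).
Proof.
move=> bH x01; rewrite (E_split hM ha0 haM (bmeas_sq_section (bmeas_sq_iter 1 bH) x01)).
apply: eq_bigr => i _; congr (_ * _); apply: E_eq => t; rewrite unitIE => Dt.
by rewrite /= /baker/= fa_inv_branch ?gab_inv_branch// -ltnS.
Qed.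

Let C1 := 3 / rate * ((B + B + K) * (B + B + K)).
Definition varbound := (B + B) ^+ 2 + 2 * (C1 / (1 - rate)).

Lemma C1_ge0 : 0 <= C1.
Proof.
have [B0 K0] := obs_ge0 oF.
by rewrite mulr_ge0 ?divr_ge0 ?(ltW rate_gt0)// mulr_ge0// !addr_ge0.
Qed.

(** Split off the first term of the sum.  Its correlations with the later terms
    are bounded by a geometric series, by [decay_fixed], and the square of the
    remaining sum is averaged at the heights fibre_map i x, where the induction
    hypothesis applies because it is stated for all heights. *)
Lemma variance_growth n x : 0 <= x <= 1 ->
  E (fun w => birkhoff_sum n (w, x) ^+ 2) <= varbound * n%:R.
Proof.
have [_ cB _] := obs_centred.
have r1' : 0 < 1 - rate by rewrite subr_gt0 rate_lt1.
elim: n x => [|n IH] x x01.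
  rewrite mulr0; under E_eq => w Dw do rewrite /birkhoff_sum big_ord0 expr0n/=.
  by rewrite E_cst.
have bc := bmeas_sq_section (obs_bmeas_sq obs_centred) x01.
have bS2 : bmeas_sq (fun p => birkhoff_sum n p ^+ 2)
  by exact: bmeas_sqM (bmeas_sq_birkhoff_sum n) (bmeas_sq_birkhoff_sum n).
have bS2T := bmeas_sq_section (bmeas_sq_iter 1 bS2) x01.
have bi j := bmeas_sq_section (bmeas_sq_iter j (obs_bmeas_sq obs_centred)) x01.
have bx (j : 'I_n) : bmeas (fun w => centred (w, x) * centred (iter j.+1 T (w, x))).
  by apply: bmeasM => //; exact: bi.
have -> : E (fun w => birkhoff_sum n.+1 (w, x) ^+ 2) =
   E (fun w => centred (w, x) * centred (w, x)) +
   (2 * \sum_(j < n) E (fun w => centred (w, x) * centred (iter j.+1 T (w, x))) +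
   E (fun w => birkhoff_sum n (T (w, x)) ^+ 2)).
  rewrite -E_sum// -EZ; last exact: bmeas_sum.
  rewrite -ED//; last by apply: bmeasZ; exact: bmeas_sum.
  rewrite -ED//; [|exact: bmeasM|by apply: bmeasD => //; apply: bmeasZ; exact: bmeas_sum].
  apply: E_eq => w Dw; rewrite birkhoff_sumS sqrrD expr2 -addrA; congr (_ + (_ + _)).
  rewrite -mulr_natl -mulr_sumr; congr (_ * (_ * _)).
  by apply: eq_bigr => j _; rewrite -iterSr.
have e1 : E (fun w => centred (w, x) * centred (w, x)) <= (B + B) ^+ 2.
  rewrite (le_trans (ler_norm _))//; apply: E_bound; first exact: bmeasM.
  by move=> w Dw; rewrite normrM expr2 ler_pM// cB//; exact: unitI_sq.
have e2 : \sum_(j < n) E (fun w => centred (w, x) * centred (iter j.+1 T (w, x))) <=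
    C1 / (1 - rate).
  apply: (@le_trans _ _ (\sum_(j < n) C1 * rate ^+ j)).
    apply: ler_sum => j _; rewrite (le_trans (ler_norm _))//.
    have := decay_fixed j.+1 obs_centred obs_centred x01.
    rewrite mean_centred mulr0 subr0 => /le_trans; apply.
  (* The exponent is lowered from j + 1 to j to reach a full geometric sum. *)
    rewrite exprSr mulrA -/C1 ler_piMr ?(ltW rate_lt1)//.
    by rewrite mulr_ge0 ?C1_ge0 ?exprn_ge0// ltW// rate_gt0.
  rewrite -mulr_sumr ler_wpM2l ?C1_ge0// -[leRHS]mul1r ler_pdivlMr// mulrC.
  by rewrite -opprB mulNr -subrX1 opprB gerBl exprn_ge0// ltW// rate_gt0.
have e3 : E (fun w => birkhoff_sum n (T (w, x)) ^+ 2) <= varbound * n%:R.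
  rewrite (E_baker bS2 x01); move: (varbound * n%:R) IH => v IH.
  have -> : v = \sum_(i < M.+1) branch_len i * v by rewrite -mulr_suml branch_len_sum1 mul1r.
  apply: ler_sum => i _; rewrite ler_wpM2l ?(ltW (branch_len_gt0 _ _ _ _))//.
  by apply: IH; apply: (fibre_map_itv hM ha0 haM hb0 hb1 _ x01); rewrite -ltnS.
rewrite -[n.+1%:R]natr1 mulrDr mulr1 [leRHS]addrC {1}/varbound -addrA.
by apply: (lerD e1); apply: lerD => //; rewrite ler_pM2l.
Qed.

(** The normalized sums over the first (k + 1)^2 terms have second moments
    O(1 / k^2), so they tend to 0 almost everywhere; bounded observables allow
    to interpolate between squares. *)
Lemma ae_birkhoff : ae_unit (fun w => birkhoff_avg T F (w, 0) n @[n --> \oo] --> mean F).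
Proof.
have z01 : 0 <= (0 : R) <= 1 by rewrite lexx ler01.
have V0 : 0 <= varbound.
  have := variance_growth 1 z01; rewrite mulr1; apply: le_trans.
  by apply: Rintegral_ge0 => w _; exact: sqr_ge0.
(* The index is shifted so that no normalization vanishes. *)
pose u k w := ((k.+1 ^ 2)%N%:R^-1 * birkhoff_sum (k.+1 ^ 2) (w, 0)) ^+ 2.
have bu k : bmeas (u k).
  apply: bmeasM; apply: bmeasZ; exact: (bmeas_sq_section (bmeas_sq_birkhoff_sum _)).
have uE k : E (u k) <= varbound * ((k.+1)%:R ^+ 2)^-1.
  have b2 : bmeas (fun w => birkhoff_sum (k.+1 ^ 2) (w, 0) ^+ 2).
    exact: (bmeasM (bmeas_sq_section (bmeas_sq_birkhoff_sum _) z01) (bmeas_sq_section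
      (bmeas_sq_birkhoff_sum _) z01)).
  have := variance_growth (k.+1 ^ 2) z01.
  have -> : E (u k) = ((k.+1 ^ 2)%N%:R^-1) ^+ 2 * E (fun w =>
    birkhoff_sum (k.+1 ^ 2) (w, 0) ^+ 2).
    by rewrite -EZ//; apply: E_eq => w _; rewrite /u exprMn.
  rewrite natrX => h; have k0 : 0 < (k.+1%:R ^+ 2 : R) by rewrite exprn_gt0.
  rewrite -(ler_pM2l (_ : 0 < ((k.+1%:R ^+ 2)^-1) ^+ 2)) in h;
    last by rewrite exprn_gt0// invr_gt0.
  rewrite (le_trans h)// le_eqVlt; apply/orP; left; apply/eqP.
  by field; rewrite addrC natr1 pnatr_eq0.
have uS n : \sum_(k < n) E (u k) <= varbound * 2.
  apply: (@le_trans _ _ (\sum_(k < n) varbound * ((k.+1)%:R ^+ 2)^-1)).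
    by apply: ler_sum => k _; exact: uE.
  by rewrite -mulr_sumr ler_wpM2l// sum_inv_sqr.
have := ae_summable bu (fun n w _ => sqr_ge0 _) uS; apply: ae_unit_imp => w Dw cw.
have [_ cB _] := obs_centred.
suff h : n%:R^-1 * birkhoff_sum n (w, 0) @[n --> \oo] --> 0.
  have : n%:R^-1 * birkhoff_sum n (w, 0) + mean F @[n --> \oo] --> 0 + mean F.
    by apply: cvgD => //; exact: cvg_cst.
  rewrite add0r; apply: cvg_trans; apply: near_eq_cvg; near=> n.
  rewrite /birkhoff_avg /birkhoff_sum /centred sumrB sumr_const card_ord mulrBr.
  rewrite -[X in _ - _ * X]mulr_natl mulrA mulVf ?mul1r ?subrK//.
  by rewrite pnatr_eq0 -lt0n; near: n; exists 1%N.
apply: (@square_interpolation _ (fun j => centred (iter j T (w, 0))) (B + B)).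
  by move=> j; apply: cB; apply: sq_iter; exact: unitI_sq.
have := cvg_series_cvg_0 cw; rewrite /u => h.
apply/cvgr0Pnorm_lt => e e0.
have e2 : 0 < e ^+ 2 by rewrite exprn_gt0.
move/cvgr0Pnorm_lt : h => /(_ _ e2); apply: filterS => k.
by rewrite normrX ltr_pXn2r ?nnegrE ?normr_ge0 ?(ltW e0).
Unshelve. all: by end_near. Qed.

(** Along the orbits of (w, x) and (w, 0) the values of F differ by the terms of
    a convergent series, so the averages differ by O(1 / n). *)
Lemma birkhoff_everywhere w x : contracting w -> 0 <= x <= 1 ->
  birkhoff_avg T F (w, 0) n @[n --> \oo] --> mean F ->
  birkhoff_avg T F (w, x) n @[n --> \oo] --> mean F.
Proof.
move=> gw x01 h; have [Dw cw] := gw; have [_ K0] := obs_ge0 oF.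
have z01 : 0 <= (0 : R) <= 1 by rewrite lexx ler01.
suff d : birkhoff_avg T F (w, x) n - birkhoff_avg T F (w, 0) n @[n --> \oo] --> 0.
  have -> : birkhoff_avg T F (w, x) = (fun n =>
      (birkhoff_avg T F (w, x) n - birkhoff_avg T F (w, 0) n) + birkhoff_avg T F (w, 0) n).
    by apply/funext => n; rewrite subrK.
  by rewrite -[mean F]add0r; exact: cvgD.
have ndL : {homo series (lip_cocycle ^~ w) : n m / (n <= m)%N >-> n <= m}.
  apply/nondecreasing_seqP => n; rewrite /series/= big_nat_recr//= lerDl;
    exact: lip_cocycle_ge0.
pose L := limn (series (lip_cocycle ^~ w)).
apply/cvgr0Pnorm_le => e e0; near=> n.
have n0 : 0 < n%:R :> R by rewrite ltr0n; near: n; exists 1%N.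
rewrite /birkhoff_avg -mulrBr -sumrB normrM gtr0_norm ?invr_gt0//.
rewrite ler_pdivrMl//.
apply: (@le_trans _ _ (K * L)).
  rewrite (le_trans (ler_norm_sum _ _ _))//.
  apply: (@le_trans _ _ (\sum_(j < n) K * lip_cocycle j w)).
    by apply: ler_sum => j _; exact: (obs_synchronization j oF).
  rewrite -mulr_sumr ler_wpM2l//.
  have := nondecreasing_cvgn_le ndL cw n; rewrite /series/= big_mkord; exact.
rewrite -ler_pdivrMr//; near: n; exact: nbhs_infty_ger.
Unshelve. all: by end_near. Qed.

End Birkhoff.

(** * Continuous observables *)

Lemma meanD F G : bmeas_sq F -> bmeas_sq G -> mean (fun p => F p + G p) = mean F + mean G.
Proof.
move=> bF bG; have [mF [B FB]] := bF; have [mG [C GC]] := bG.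
rewrite -ED; [|exact: bmeas_slice_mean FB|exact: bmeas_slice_mean GC].
by apply: E_eq => e _; rewrite -ED//; apply: bmeas_sq_section => //; exact: backward_limit_itv.
Qed.

Lemma meanZ c F : bmeas_sq F -> mean (fun p => c * F p) = c * mean F.
Proof.
move=> bF; have [mF [B FB]] := bF.
rewrite -EZ; last exact: bmeas_slice_mean FB.
by apply: E_eq => e _; rewrite -EZ//; apply: bmeas_sq_section => //; exact: backward_limit_itv.
Qed.

Lemma mean0 : mean (fun=> 0) = 0.
Proof.
rewrite -[RHS](mul0r (mean (fun=> 0))) -meanZ; last exact: bmeas_sq_cst.
by congr mean; apply/funext => p; rewrite mul0r.
Qed.

Lemma bmeas_sqZ c F : bmeas_sq F -> bmeas_sq (fun p => c * F p).
Proof. exact: (bmeas_sqM (bmeas_sq_cst c)). Qed.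

Lemma bmeas_sq_sum n (F : nat -> plane R -> R) : (forall i, bmeas_sq (F i)) ->
  bmeas_sq (fun p => \sum_(i < n) F i p).
Proof.
move=> bF; elim: n => [|n IH].
  by have := bmeas_sq_cst 0; congr bmeas_sq; apply/funext => p; rewrite big_ord0.
have := bmeas_sqD IH (bF n); congr bmeas_sq; apply/funext => p.
by rewrite big_ord_recr.
Qed.

Lemma mean_sum n (F : nat -> plane R -> R) : (forall i, bmeas_sq (F i)) ->
  mean (fun p => \sum_(i < n) F i p) = \sum_(i < n) mean (F i).
Proof.
move=> bF; elim: n => [|n IH].
  by rewrite big_ord0 -[RHS]mean0; congr mean; apply/funext => p; rewrite big_ord0.
rewrite [RHS]big_ord_recr -IH; apply: etrans (meanD (bmeas_sq_sum n bF) (bF n)).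
by congr mean; apply/funext => p; rewrite big_ord_recr.
Qed.

Lemma birkhoffZ c F y n : birkhoff_avg T (fun p => c * F p) y n = c * birkhoff_avg T F y n.
Proof. by rewrite /birkhoff_avg -mulr_sumr mulrCA. Qed.

Lemma birkhoff_dist F G e y n : sq y -> 0 <= e -> (forall p, sq p -> `|F p - G p| <= e) ->
  `|birkhoff_avg T F y n - birkhoff_avg T G y n| <= e.
Proof.
move=> sy e0 h; rewrite /birkhoff_avg -mulrBr -sumrB normrM.
case: n => [|n]; first by rewrite big_ord0 normr0 mulr0.
rewrite gtr0_norm ?invr_gt0// ler_pdivrMl//.
rewrite (le_trans (ler_norm_sum _ _ _))// mulr_natl -[X in _ *+ X](card_ord n.+1) -sumr_const.
by apply: ler_sum => j _; apply: h; exact: sq_iter.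
Qed.

Lemma mean_dist F G e : bmeas_sq F -> bmeas_sq G -> (forall p, sq p -> `|F p - G p| <= e) ->
  `|mean F - mean G| <= e.
Proof.
move=> bF bG h; have [mF [B FB]] := bF; have [mG [C GC]] := bG.
rewrite -EB; [|exact: bmeas_slice_mean FB|exact: bmeas_slice_mean GC].
apply: E_bound => [|x _]; first by apply: bmeasB;
  [exact: bmeas_slice_mean FB|exact: bmeas_slice_mean GC].
rewrite -EB; [|by apply: bmeas_sq_section => //; exact: backward_limit_itv..].
apply: E_bound => [|w Dw].
  by apply: bmeasB; apply: bmeas_sq_section => //; exact: backward_limit_itv.
by apply: h; apply: unitI_sq => //; exact: backward_limit_itv.
Qed.

Lemma obs_tile N i j : obs (tile N i j) 1 (2 * N%:R).
Proof.
split; first exact: measurable_tile.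
- by move=> p _; have /andP[? ?] := tile_itv N i j p; rewrite ger0_norm.
- by move=> p q _ _; exact: tile_lip.
Qed.

Lemma bmeas_sq_grid phi N : bmeas_sq (grid phi N).
Proof.
apply: (bmeas_sq_sum N.+1 (F := fun i p =>
  \sum_(j < N.+1) phi (i%:R / N%:R, j%:R / N%:R) * tile N i j p)) => i.
apply: (bmeas_sq_sum N.+1 (F := fun j p => phi (i%:R / N%:R, j%:R / N%:R) * tile N i j p)) => j.
by apply: bmeas_sqZ; exact: obs_bmeas_sq (obs_tile _ _ _).
Qed.

(** A continuous function is a uniform limit of grid functions, which are
    measurable for the product sigma-algebra. *)
Lemma continuous_bmeas_sq (phi : R * R -> R) : {within sq, continuous phi} ->
  bmeas_sq (phi \_ sq).
Proof.
move=> cphi.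
have ex k : exists N, forall p, sq p -> `|phi p - grid phi N.+1 p| <= k.+1%:R^-1.
  have e0 : 0 < k.+1%:R^-1 :> R by rewrite invr_gt0.
  have [N hN] := uniformly_continuous_sq cphi e0.
  by exists N; exact: (grid_approx (ltW e0) hN).
split; last first.
  have [N hN] := ex 0%N; have [_ [C hC]] := bmeas_sq_grid phi N.+1.
  exists (1 + C) => p sp; rewrite patchE mem_set//.
  rewrite -[phi p](subrK (grid phi N.+1 p)) (le_trans (ler_normD _ _))// lerD ?hC//.
  by rewrite (le_trans (hN _ sp))// invr1.
apply/(measurable_restrictT _ _).1; first exact: measurable_sq.
have /choice[N hN] := ex.
apply: (@measurable_fun_cvg _ _ _ _ (fun k => grid phi (N k).+1)).
  by move=> k; apply: measurable_funTS; exact: measurable_grid.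
move=> p sp; apply/cvgrPdist_le => e e0; near=> k.
by rewrite (le_trans (hN k p sp))// ltW//; near: k; exact: near_infty_natSinv_lt (PosNum e0).
Unshelve. all: by end_near. Qed.

(** Convergence is required of countably many observables only, so that it holds
    almost everywhere; they suffice for all continuous functions. *)
Definition generic (w : R) : Prop := contracting w /\
  forall N i j, birkhoff_avg T (tile N i j) (w, 0) n @[n --> \oo] --> mean (tile N i j).

Lemma ae_generic : ae_unit generic.
Proof.
apply: ae_unit_and ae_contracting _.
apply: ae_unit_foralln => N; apply: ae_unit_foralln => i; apply: ae_unit_foralln => j.
exact: ae_birkhoff (obs_tile N i j).
Qed.

Lemma generic_grid phi N w x : generic w -> 0 <= x <= 1 ->
  birkhoff_avg T (grid phi N) (w, x) n @[n --> \oo] --> mean (grid phi N).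
Proof.
move=> [gw ht] x01.
have bt i j := obs_bmeas_sq (obs_tile N i j).
have btc i j := bmeas_sqZ (phi (i%:R / N%:R, j%:R / N%:R)) (bt i j).
pose row i p := \sum_(j < N.+1) phi (i%:R / N%:R, j%:R / N%:R) * tile N i j p.
have brow i : bmeas_sq (row i) by apply: (bmeas_sq_sum N.+1 (btc i)).
have lin (F : nat -> plane R -> R) m : (forall i, bmeas_sq (F i)) ->
    (forall i, birkhoff_avg T (F i) (w, x) n @[n --> \oo] --> mean (F i)) ->
    birkhoff_avg T (fun p => \sum_(i < m) F i p) (w, x) n @[n --> \oo] -->
      mean (fun p => \sum_(i < m) F i p).
  move=> bF cF; rewrite mean_sum//.
  have -> : birkhoff_avg T (fun p => \sum_(i < m) F i p) (w, x) =
      (fun n => \sum_(i < m) birkhoff_avg T (F i) (w, x) n).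
    by apply/funext => n; rewrite /birkhoff_avg -mulr_sumr exchange_big.
  elim: m => [|m IH].
    by under eq_cvg do rewrite big_ord0; rewrite big_ord0; exact: cvg_cst.
  by under eq_cvg do rewrite big_ord_recr; rewrite big_ord_recr; apply: cvgD.
apply: (lin row) => // i.
apply: (lin (fun j p => phi (i%:R / N%:R, j%:R / N%:R) * tile N i j p)) => // j.
rewrite meanZ//; under eq_cvg do rewrite birkhoffZ.
apply: cvgMr; apply: (birkhoff_everywhere (obs_tile N i j) gw x01); exact: ht.
Qed.

Lemma generic_basin w x : generic w -> 0 <= x <= 1 -> basin T phys_measure (w, x).
Proof.
move=> gw x01; have sy : sq (w, x) by apply: unitI_sq => //; exact: gw.1.1.
split => // phi cphi.
have bphi := continuous_bmeas_sq cphi; have [mphi [B phiB]] := bphi.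
have -> : \int[phys_measure]_(p in sq) phi p = mean (phi \_ sq).
  rewrite -(phys_measure_mean mphi phiB); apply: eq_Rintegral => p sp.
  by rewrite patchE sp.
apply/cvgrPdist_le => e e0; have e3 : 0 < e / 3 by rewrite divr_gt0.
have [N hN] := uniformly_continuous_sq cphi e3.
have ga := grid_approx (ltW e3) hN.
have gm : `|mean (phi \_ sq) - mean (grid phi N.+1)| <= e / 3.
  apply: mean_dist => //; first exact: bmeas_sq_grid.
  by move=> p sp; rewrite patchE mem_set//; exact: ga.
have /cvgrPdist_le/(_ _ e3) := @generic_grid phi N.+1 w x gw x01.
apply: filterS => n h.
have := birkhoff_dist n sy (ltW e3) ga.
rewrite distrC => hb; rewrite (le_trans (ler_distD (mean (grid phi N.+1)) _ _))//.
rewrite (_ : e = e / 3 + (e / 3 + e / 3)); last by field.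
rewrite lerD// (le_trans (ler_distD (birkhoff_avg T (grid phi N.+1) (w, x) n) _ _))//.
by rewrite lerD.
Qed.

(** * Physicality, uniqueness and decay *)

(** The point 1 joins the exceptional set because [unitI] is half-open. *)
Lemma null_generic : exists N : set (measurableTypeR R), [/\ measurable N, lam N = 0%E &
  forall w x, sq (w, x) -> ~ N w -> basin T phys_measure (w, x)].
Proof.
have [N [mN N0 hN]] := ae_generic.
exists (N `|` [set 1]); split.
- by apply: measurableU => //; exact: measurable_set1.
- by rewrite measureU0//; exact: lebesgue_measure_set1.
- move=> w x swx /not_orP[Nw w1].
  move: swx; rewrite sqE/= => -[/andP[w0 wle1] x01].
  have Dw : unitI w by rewrite unitIE w0/= lt_neqAle wle1 andbT; apply/eqP.
  apply: generic_basin => //; have [//|ng] := pselect (generic w).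
  by exfalso; apply/Nw/hN => /= h; apply: ng; exact: h.
Qed.

Lemma basin_ae : {ae (@leb2 R), forall y, sq y -> basin T phys_measure y}.
Proof.
have [N [mN N0 hN]] := null_generic.
exists (N `*` setT); split.
- by apply: measurableX => //; exact: measurableT.
- by rewrite leb2_setX// N0 mul0e.
- move=> [w x] /= h; split => //=; have [//|Nw] := pselect (N w).
  by exfalso; apply: h => sy; exact: hN.
Qed.

(** The basin contains a product of Borel sets of measure 1. *)
Lemma physical_phys_measure : physical T phys_measure.
Proof.
split; first exact: phys_measure_invariant.
have [N [mN N0 hN]] := null_generic.
pose I : set (measurableTypeR R) := `[0, 1]%classic.
have mI : measurable I by exact: measurable_itv.
have mD : measurable (I `\` N).
  exact: measurableD.
apply: (@lt_le_trans _ _ (leb2 ((I `\` N) `*` I))); last first.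
  apply: le_leb2 => -[w x] [/= [w01 Nw] x01]; apply: hN => //; by split.
have I1 : lam I = 1%E.
  by rewrite lebesgue_measure_itv/= lte_fin ltr01 oppr0 adde0.
have D1 : lam (I `\` N) = 1%E.
  have h1 : (lam (I `\` N) <= 1)%E.
    by rewrite -I1; apply: le_lebesgue_measure => w [].
  have h2 : (1 <= lam (I `\` N) + lam N)%E.
    rewrite -I1; apply: le_trans (measureU2 _ mD mN).
    by apply: le_lebesgue_measure => w w01; have [Nw|Nw] := pselect (N w); [right|left].
  by apply/eqP; rewrite eq_le h1/=; move: h2; rewrite N0 adde0.
by rewrite leb2_setX// D1 I1 mule1 lte_fin.
Qed.

(** If the two basins were disjoint, that of nu would lie in the exceptional
    null set.  A common point has its Birkhoff averages converging to the
    integrals for both measures. *)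
Lemma physical_unique (nu : probability (plane R) R) : physical T nu ->
  forall A, measurable A -> nu A = phys_measure A.
Proof.
move=> [[nu1 _] nub]; have [N [mN N0 hN]] := null_generic.
have [[y [y1 y2]]|no] := pselect (exists y, basin T nu y /\ basin T phys_measure y).
  apply: determined_by_continuous => //; first exact: phys_measure_sq.
  move=> phi cphi; have c1 := y1.2 phi cphi; have c2 := y2.2 phi cphi.
  by rewrite -(cvg_lim _ c1)// -(cvg_lim _ c2).
exfalso; move: nub; apply/negP; rewrite -leNgt.
apply: (@le_trans _ _ (leb2 (N `*` setT))); last by rewrite leb2_setX// N0 mul0e.
apply: le_leb2 => -[w x] by1; split => //=; have [//|Nw] := pselect (N w).
by exfalso; apply: no; exists (w, x); split => //; apply: hN => //; exact: by1.1.
Qed.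

Lemma obs_lipschitz (phi : plane R -> R) : lipschitz_sq phi ->
  obs (phi \_ sq) (sup_norm phi) (lip_const phi).
Proof.
move=> lphi; have [mphi [B hB]] := continuous_bmeas_sq (lipschitz_continuous lphi).
split => //.
- move=> p sp; rewrite patchE mem_set//; apply: sup_norm_ge => //.
  by exists B => q sq'; have := hB q sq'; rewrite patchE mem_set.
- by move=> p q sp sq'; rewrite !patchE !mem_set//; exact: lip_constP.
Qed.

Lemma decay_lipschitz (Phi Psi : plane R -> R) n : lipschitz_sq Phi -> lipschitz_sq Psi ->
  `| \int[phys_measure]_(p in sq) (Phi p * Psi (iter n T p))
     - (\int[phys_measure]_(p in sq) Phi p) * (\int[phys_measure]_(p in sq) Psi p) |
  <= 3 / rate * (lip_norm Phi * lip_norm Psi) * rate ^+ n.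
Proof.
move=> lPhi lPsi; have o1 := obs_lipschitz lPhi; have o2 := obs_lipschitz lPsi.
have b1 := obs_bmeas_sq o1; have b2 := obs_bmeas_sq o2.
have intE (F G : plane R -> R) : bmeas_sq G -> (forall p, sq p -> F p = G p) ->
    \int[phys_measure]_(p in sq) F p = mean G.
  move=> [mG [B GB]] FG; rewrite -(phys_measure_mean mG GB); apply: eq_Rintegral => p.
  by rewrite inE; exact: FG.
rewrite (intE Phi _ b1) => [|p sp]; last by rewrite patchE mem_set.
rewrite (intE Psi _ b2) => [|p sp]; last by rewrite patchE mem_set.
rewrite (intE _ _ (bmeas_sqM b1 (bmeas_sq_iter n b2))) => [|p sp]; last first.
  by rewrite !patchE !mem_set//; exact: sq_iter.
exact: decay_mean.
Qed.

End SkewProduct.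

Theorem corollary4 (R : realType) (M : nat) (a b : R)
  (hM : (2 <= M)%N) (ha0 : 0 < a) (haM : a < 1 / M%:R)
  (hb0 : 0 < b) (hbM : b < M%:R `^ (1 - 1 / (M%:R * a))) :
  exists mu : probability (plane R) R,
    [/\ physical (baker M a b) mu,
        (forall nu : probability (plane R) R, physical (baker M a b) nu ->
           forall A : set (plane R), measurable A -> nu A = mu A),
        {ae (@leb2 R), forall y, sq y -> basin (baker M a b) mu y}
      & exists C s : R, [/\ 0 < C, 0 < s, s < 1
          & forall Phi Psi : plane R -> R,
              lipschitz_sq Phi -> lipschitz_sq Psi ->
              forall n : nat, (1 <= n)%N ->
                `| \int[mu]_(p in sq) (Phi p * Psi (iter n (baker M a b) p))
                   - (\int[mu]_(p in sq) Phi p) * (\int[mu]_(p in sq) Psi p) |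
                <= C * (lip_norm Phi * lip_norm Psi) * s ^+ n]].
Proof.
have [hb1 [th /andP[th0 th1] r1]] := contracting_on_average hM ha0 haM hb0 hbM.
exists (phys_measure hM ha0 haM hb0 hb1); split.
- exact: (physical_phys_measure hM ha0 haM hb0 hb1 th0 th1 r1).
- by move=> nu pnu A mA; exact: (physical_unique hM ha0 haM hb0 hb1 th0 th1 r1 pnu mA).
- exact: (basin_ae hM ha0 haM hb0 hb1 th0 th1 r1).
- exists (3 / rate M a b th), (rate M a b th).
  have s0 : 0 < rate M a b th by exact: rate_gt0.
  split => //; [by rewrite divr_gt0|exact: rate_lt1|].
  by move=> Phi Psi lPhi lPsi n _; exact: (decay_lipschitz hM ha0 haM hb0 hb1 th0 th1 r1).
Qed.
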